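(* Let $k\ge 2$. There is $N$ such that for all $n\ge N$ the following holds: the only edges $e\subseteq V_n$ of $\Delta^{2k-1}_n$ whose links $\mathrm{lk}(e,\Delta^{2k-1}_n)$ are cs-$(k-1)$-neighborly (with respect to $V_n\setminus(e\cup -e)$) are $e=\pm\{1,2\}$ and $e=\pm\{n-1,n\}$. Furthermore, the links of these four edges are centrally symmetric (closed under $\sigma\mapsto-\sigma$).
   Context: Simplicial complexes are finite abstract simplicial complexes. For a finite set $A$, $\overline{A}$ is the simplex of all subsets of $A$. $V_n=\{\pm1,\dots,\pm n\}$. For a set $\sigma$ of integers, $-\sigma=\{-v:v\in\sigma\}$; for a complex $\Gamma$, $-\Gamma=\{-\sigma:\sigma\in\Gamma\}$. The join is $\Gamma*\Gamma'=\{\sigma\cup\tau:\sigma\in\Gamma,\tau\in\Gamma'\}$ (disjoint vertex sets); $\Gamma*v:=\Gamma*\overline{\{v\}}$. A path $(v_1,\dots,v_m)$ is the 1-dimensional complex with edges $\{v_j,v_{j+1}\}$ (a cycle if $v_m=v_1$). $\partial C^*_m$ is the complex of all subsets of $V_m$ containing no pair $\{j,-j\}$. For a pure complex $\Delta$ and pure full-dimensional subcomplex $\Gamma$, $\Delta\setminus\Gamma$ is the subcomplex generated by the facets of $\Delta$ not in $\Gamma$. $\partial B$ is the boundary complex of a combinatorial ball $B$; $\mathrm{lk}(\tau,\Delta)=\{\sigma\in\Delta:\sigma\cap\tau=\emptyset,\ \sigma\cup\tau\in\Delta\}$. The complexes $\Delta^d_n$ ($d\ge1$, $n\ge d+1$)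 and $B^{d,i}_n$ are defined recursively: $\Delta^1_n$ is the cycle $(1,2,\dots,n,-1,\dots,-n,1)$; $\Delta^d_{d+1}=\partial C^*_{d+1}$; $B^{d,j}_n=\emptyset$ for $j<0$; $B^{1,0}_n=\overline{\{-1,n\}}$; for $k\ge1$, $n\ge2k$: $B^{2k-1,k}_n=\Delta^{2k-1}_n\setminus B^{2k-1,k-1}_n$; for $d\ge2$, $n\ge d+1$, $i\le\lfloor d/2\rfloor$: $B^{d,i}_n=(B^{d-1,i}_{n-1}*n)\cup((-B^{d-1,i-1}_{n-1})*(-n))$; $\Delta^d_{n+1}$ is obtained from $\Delta^d_n$ by replacing $B=B^{d,\lceil d/2\rceil-1}_n$ with $\partial B*(n+1)$ and $-B$ with $\partial(-B)*(-n-1)$. (These are known to be well defined; $\Delta^d_n$ is a combinatorial $d$-sphere on $V_n$ invariant under $v\mapsto-v$.) A complex is cs-$i$-neighborly with respect to a vertex set $V=-V$ if every subset of $V$ of size at most $i$ containing no pair $\{v,-v\}$ is a face. *)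

(* Defs.v *)
From mathcomp Require Export all_boot all_order all_algebra.
From mathcomp Require Export finmap.
Set Implicit Arguments.
Unset Strict Implicit.
Unset Printing Implicit Defensive.
Import Order.TTheory GRing.Theory Num.Theory.
Local Open Scope ring_scope.
Local Open Scope fset_scope.

(* A complex is represented by the finite set of all its faces. The void
   complex [fset0] (no faces) differs from [[fset fset0]] (only the empty
   face); in the recursion below the empty complex is [fset0], so that its
   join with anything is void. *)
Notation face := {fset int}.
Notation complex := {fset {fset int}}.

Definition opp_face (s : face) : face := [fset - v | v in s].

Definition opp_complex (G : complex) : complex := [fset opp_face s | s in G].

Definition simplex (A : face) : complex := fpowerset A.

Definition generated (S : complex) : complex :=
  \bigcup_(F <- S) simplex F.

Definition join (G H : complex) : complex := [fset s `|` t | s in G, t in H].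

Definition cone (G : complex) (v : int) : complex := join G (simplex [fset v]).

Definition facets (G : complex) : complex :=
  [fset F in G | [fset F' in G | F `<` F'] == fset0].

Definition cdiff (D G : complex) : complex :=
  generated [fset F in facets D | F \notin G].

(* The usual description of the boundary of a combinatorial ball G, which is
   pure, so that the generators are its codimension-one faces. *)
Definition boundary (G : complex) : complex :=
  generated [fset s in G |
    #|` [fset F in facets G | (s `<=` F) && (#|` F| == #|` s|.+1)] | == 1%N].

Definition link (t : face) (D : complex) : complex :=
  [fset s in D | [disjoint s & t]%fset && (s `|` t \in D)].

Definition V (n : nat) : face :=
  let P : face := [fset i%:Z | i in iota 1 n] in P `|` opp_face P.

(* On sets of nonzero integers: no pair {v, -v} is contained in s. *)
Definition antipode_free (s : face) : bool := [disjoint s & opp_face s]%fset.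

Definition cross_bd (m : nat) : complex :=
  [fset s in fpowerset (V m) | antipode_free s].

Definition path_complex (s : seq int) : complex :=
  generated [fset [fset p.1; p.2] | p in zip s (behead s)].

Definition cycle_complex (n : nat) : complex :=
  path_complex ([seq i%:Z | i <- iota 1 n] ++ [seq - i%:Z | i <- iota 1 n]
                ++ [:: 1]).

Definition replace_balls (D B : complex) (v : int) : complex :=
  cdiff D (B `|` opp_complex B) `|` cone (boundary B) v
                         `|` cone (boundary (opp_complex B)) (- v).

(* The recursion is organised by d: [Delta_from d B] is Delta^d, given the
   family B = B^{d,_}_, of which only the index ceil(d/2) - 1 is used. Values
   outside d >= 1 and n >= d + 1 are irrelevant. *)
Fixpoint Delta_from (d : nat) (B : int -> nat -> complex) (n : nat) : complex :=
  if d == 1%N then cycle_complex n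
  else if n is m.+1 then
    if (d < m)%N then
      replace_balls (Delta_from d B m) (B ((uphalf d)%:Z - 1) m) m.+1%:Z
    else cross_bd d.+1
  else cross_bd d.+1.

(* B^{d,i}_n; [low] is its value for i <= floor(d/2), while an index above
   floor(d/2) is only meaningful if d = 2k - 1 and i = k. *)
Fixpoint ball (d : nat) : int -> nat -> complex :=
  if d is d'.+1 then
    let low (i : int) (n : nat) : complex :=
      if (i < 0)%R then fset0
      else if d' == 0%N then simplex [fset -1; n%:Z]
      else cone (ball d' i n.-1) n%:Z
           `|` cone (opp_complex (ball d' (i - 1) n.-1)) (- n%:Z) in
    fun i n =>
      if (i <= (d./2)%:Z)%R then low i n
      else cdiff (Delta_from d low n) (low (i - 1) n)
  else fun _ _ => fset0.

Definition Delta (d n : nat) : complex := Delta_from d (ball d) n.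

Definition cs_neighborly (i : nat) (W : face) (D : complex) : Prop :=
  forall s : face, s `<=` W -> (#|` s| <= i)%N -> antipode_free s -> s \in D.

Definition centrally_symmetric (D : complex) : Prop :=
  forall s : face, s \in D -> opp_face s \in D.

Lemma Delta1 n : Delta 1 n = cycle_complex n.
Proof. by rewrite /Delta; case: n. Qed.

Lemma Delta_min d : (2 <= d)%N -> Delta d d.+1 = cross_bd d.+1.
Proof. by case: d => [|[|d]] //= _; rewrite /Delta /= ltnn. Qed.

Lemma Delta_succ d n : (2 <= d)%N -> (d.+1 <= n)%N ->
  Delta d n.+1 =
  replace_balls (Delta d n) (ball d ((uphalf d)%:Z - 1) n) n.+1%:Z.
Proof. by rewrite /Delta; case: d => [|[|d]] //= _ ->. Qed.

Lemma ball_neg d (j : int) n : (j < 0)%R -> ball d j n = fset0.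
Proof.
case: d => // d j0; have -> : ball d.+1 j n = fset0; last by [].
by rewrite /ball -/ball (le_trans (ltW j0)) // j0.
Qed.

Lemma ball10 n : ball 1 0 n = simplex [fset -1; n%:Z].
Proof. by []. Qed.

Lemma ball_rec d (i : int) n : (2 <= d)%N -> (0 <= i)%R ->
    (i <= (d./2)%:Z)%R ->
  ball d i n = cone (ball d.-1 i n.-1) n%:Z
               `|` cone (opp_complex (ball d.-1 (i - 1) n.-1)) (- n%:Z).
Proof.
by case: d => [|[|d]] // _ i0 id; move: id => /= ->; rewrite ltNge i0.
Qed.

Lemma eq_Delta_from d B B' : (forall n, B ((uphalf d)%:Z - 1) n =
    B' ((uphalf d)%:Z - 1) n) -> Delta_from d B =1 Delta_from d B'.
Proof. by move=> eB; elim=> [//|n IHn] /=; rewrite IHn eB. Qed.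

Lemma ball_top k n : (1 <= k)%N ->
  ball (2 * k - 1) k%:Z n =
  cdiff (Delta (2 * k - 1) n) (ball (2 * k - 1) (k%:Z - 1) n).
Proof.
case: k => // k _; rewrite (_ : (2 * k.+1 - 1 = k.*2.+1)%N); last first.
  by rewrite mul2n doubleS subn1.
have hk : (k.*2.+1)./2 = k by rewrite /= uphalf_double.
have hu : uphalf k.*2.+1 = k.+1 by rewrite /= doubleK.
have ek : k.+1%:Z - 1 = k%:Z :> int by rewrite -addn1 PoszD addrK.
rewrite /Delta {1 3}/ball -/ball hk lez_nat ltnn ek lexx.
congr (cdiff _ _); apply: eq_Delta_from => m.
by rewrite hu ek /ball -/ball hk lexx.
Qed.

(* Main.v *)
(* All complexes involved are pure, so the recursion can be run on sets of
   facets. A simultaneous induction on the dimension shows that every ridge lies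
   in at most two facets of B^{d,i}, that boundaries of balls and the spheres
   Delta^{2k-1} are closed (each ridge lies in none or two facets), and that
   B^{d,i-1} and B^{d,i} share no facet while -B^{d,i-1} is contained in B^{d,i}.

   Neighborliness of the four links: B^{d,i} contains all small antipode-free
   sets, and all its small faces are on its boundary, hence survive each
   replacement of balls. The link of {n-1, n} is Delta^{2k-3}_{n-2}. Replacing
   {1, 2} by {-1, -2} maps facets to facets, as the recursion only touches
   larger vertices; with the invariance under the antipode this makes the link
   of {1, 2} centrally symmetric.

   For any other edge e one exhibits a missing (k+1)-set containing e. Adding to
   a set S a vertex far above S lowers by 2 the dimension of the sphere in which
   S would have to be a face, so that widely spaced vertices beyond a missing
   edge or triangle give missing sets. The edges {b-1, b} with b < n use that all
   facets containing {b-1, b} and otherwise vertices below are removed when b+1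
   enters, and {b-2, b} is completed by the vertex -(b-1). *)

Require Import Defs.
From mathcomp Require Import zify.
Import Order.TTheory GRing.Theory Num.Theory.
Set Implicit Arguments.
Unset Strict Implicit.
Unset Printing Implicit Defensive.
Local Open Scope ring_scope.
Local Open Scope fset_scope.

(** * Facet sets and boundaries *)

(** The obstacle in the induction is that each sphere has to contain the ball along which it is cut
    next. The cones over B^{d,i}_n and -B^{d,i-1}_n that form B^{d+1,i}_{n+1} lie in the cones glued
    in at that step if B^{d,i}_n and B^{d,i-1}_n lie on the boundary of B^{d+1,i}_n; hence
    boundaries are part of the induction. Topology is replaced by counting the facets over a ridge.
    The link of {n-1, n} is a sphere because the boundary of B^{2k-2,k-1}_{n-2} is exactly
    Delta^{2k-3}_{n-2}: the recursion for this boundary coincides with the replacement step. For the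
    other edges {a, b} the problem is room. A missing set needs up to k - 1 further vertices with
    gaps of about 2k, so a quadratic number of levels. They are put above b if b is far from n,
    between |a| and |b| if these are far apart, and below |a| if both are near n; the bound N
    ensures that one of the three positions is wide enough. *)

Lemma in_opp_face (x : int) (s : face) : (x \in opp_face s) = (- x \in s).
Proof.
apply/imfsetP/idP => [[y /= ys ->]|xs]; first by rewrite opprK.
by exists (- x); rewrite //= opprK.
Qed.

Lemma opp_faceK : involutive opp_face.
Proof. by move=> s; apply/fsetP => x; rewrite !in_opp_face opprK. Qed.

Lemma opp_faceU (s t : face) : opp_face (s `|` t) = opp_face s `|` opp_face t.
Proof. by apply/fsetP => x; rewrite !(inE, in_opp_face). Qed.

Lemma opp_faceD (s t : face) : opp_face (s `\` t) = opp_face s `\` opp_face t.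
Proof. by apply/fsetP => x; rewrite !(inE, in_opp_face). Qed.

Lemma opp_face1 (x : int) : opp_face [fset x] = [fset - x].
Proof. by apply/fsetP => y; rewrite in_opp_face !inE eqr_oppLR. Qed.

Lemma opp_faceS (s t : face) : (opp_face s `<=` opp_face t) = (s `<=` t).
Proof.
apply/fsubsetP/fsubsetP => st x.
  by have := st (- x); rewrite !in_opp_face opprK.
by rewrite !in_opp_face => /st.
Qed.

Lemma card_opp_face (s : face) : #|` opp_face s| = #|` s|.
Proof. by rewrite /opp_face card_imfset //=; apply: oppr_inj. Qed.

Lemma in_opp_complex (F : face) (S : complex) :
  (F \in opp_complex S) = (opp_face F \in S).
Proof.
apply/imfsetP/idP => [[y /= ys ->]|xs]; first by rewrite opp_faceK.
by exists (opp_face F); rewrite //= opp_faceK.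
Qed.

Lemma opp_complexK : involutive opp_complex.
Proof. by move=> s; apply/fsetP => x; rewrite !in_opp_complex opp_faceK. Qed.

Lemma opp_complexD (S T : complex) :
  opp_complex (S `\` T) = opp_complex S `\` opp_complex T.
Proof. by apply/fsetP => x; rewrite !(inE, in_opp_complex). Qed.

Lemma inV (x : int) n : (x \in V n) = (0 < `|x| <= n)%N.
Proof.
rewrite /V in_fsetU in_opp_face.
have mP y : (y \in [fset i%:Z | i in iota 1 n]) = (0 < y <= n%:Z).
  apply/imfsetP/idP => [[i /=]|yn]; first by rewrite mem_iota => + ->; lia.
  by exists `|y|%N; rewrite /= ?mem_iota; lia.
by rewrite !mP; lia.
Qed.

Lemma antipode_freeP (s : face) :
  reflect (forall x, x \in s -> - x \notin s) (antipode_free s).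
Proof.
apply: (iffP idP) => [/fdisjointP h x xs|h].
  by have := h x xs; rewrite in_opp_face.
by apply/fdisjointP => x xs; rewrite in_opp_face h.
Qed.

Lemma antipode_freeS (s t : face) :
  s `<=` t -> antipode_free t -> antipode_free s.
Proof.
move=> /fsubsetP st /antipode_freeP h; apply/antipode_freeP => x xs.
by apply/negP => /st; apply/negP/h/st.
Qed.

Lemma antipode_free_opp (s : face) : antipode_free (opp_face s) = antipode_free s.
Proof. by rewrite /antipode_free opp_faceK fdisjoint_sym. Qed.

Lemma opp_V n : opp_face (V n) = V n.
Proof. by apply/fsetP => x; rewrite in_opp_face !inV abszN. Qed.

Lemma subV (s : face) m n : (m <= n)%N -> s `<=` V m -> s `<=` V n.
Proof.
by move=> mn /fsubsetP sV; apply/fsubsetP => x /sV; rewrite !inV; lia.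
Qed.

Lemma in_generated (X : face) (S : complex) :
  reflect (exists2 F, F \in S & X `<=` F) (X \in generated S).
Proof.
apply: (iffP idP) => [/bigfcupP[F /andP[FS _]]|[F FS XF]].
  by rewrite fpowersetE => XF; exists F.
by apply/bigfcupP; exists F; rewrite ?FS // fpowersetE.
Qed.

Lemma generated_sub (X Y : face) (S : complex) :
  X `<=` Y -> Y \in generated S -> X \in generated S.
Proof.
move=> XY /in_generated[F FS YF]; apply/in_generated; exists F => //.
exact: fsubset_trans YF.
Qed.

Lemma generatedS (S T : complex) : S `<=` T -> generated S `<=` generated T.
Proof.
move=> /fsubsetP ST; apply/fsubsetP => X /in_generated[F FS XF].
by apply/in_generated; exists F => //; apply: ST.
Qed.

Lemma generatedU (S T : complex) :
  generated (S `|` T) = generated S `|` generated T.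
Proof.
apply/fsetP => X; rewrite in_fsetU; apply/idP/orP => [/in_generated[F]|].
  by rewrite inE => /orP[] FS XF; [left|right]; apply/in_generated; exists F.
by case=> /in_generated[F FS XF]; apply/in_generated; exists F => //;
  rewrite inE FS ?orbT.
Qed.

Lemma generated_opp (S : complex) :
  generated (opp_complex S) = opp_complex (generated S).
Proof.
apply/fsetP => X; rewrite in_opp_complex.
apply/in_generated/in_generated => -[F FS XF]; exists (opp_face F).
- by rewrite -in_opp_complex.
- by rewrite opp_faceS.
- by rewrite in_opp_complex opp_faceK.
- by rewrite -opp_faceS opp_faceK.
Qed.

Definition join1 (P : complex) (v : int) : complex :=
  [fset v |` F | F in [fset G in P | v \notin G]].

Lemma in_join1 (P : complex) v F :
  (F \in join1 P v) = (v \in F) && (F `\ v \in P).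
Proof.
apply/imfsetP/andP => [[G /=]|[vF FP]].
  by rewrite !inE => /andP[GP vG] ->; rewrite fset1U1 fsetU1K.
by exists (F `\ v); rewrite /= ?inE ?FP ?eqxx // fsetD1K.
Qed.

Lemma opp_join1 (P : complex) v :
  opp_complex (join1 P v) = join1 (opp_complex P) (- v).
Proof.
apply/fsetP => F; rewrite !(in_join1, in_opp_complex) in_opp_face.
by rewrite opp_faceD opp_face1 opprK.
Qed.

Lemma opp_complexU (S T : complex) :
  opp_complex (S `|` T) = opp_complex S `|` opp_complex T.
Proof. by apply/fsetP => x; rewrite !(inE, in_opp_complex). Qed.

Lemma opp_complexS (S T : complex) :
  (opp_complex S `<=` opp_complex T) = (S `<=` T).
Proof.
apply/fsubsetP/fsubsetP => st x.
  by have := st (opp_face x); rewrite !in_opp_complex opp_faceK.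
by rewrite !in_opp_complex => /st.
Qed.

Lemma join1S (P Q : complex) v : P `<=` Q -> join1 P v `<=` join1 Q v.
Proof.
move=> /fsubsetP PQ; apply/fsubsetP => F; rewrite !in_join1.
by move=> /andP[-> /PQ].
Qed.

(** A facet over the ridge [r] is recorded by its one vertex outside [r], so that degrees are
    cardinals of sets of vertices. The union of all facets bounds the comprehension. *)
Definition covertex (S : complex) (r : face) : face :=
  [fset x in \bigcup_(F <- S) F | (x \notin r) && (x |` r \in S)].

Definition deg (S : complex) (r : face) : nat := #|` covertex S r|.

(** The ridges themselves are kept, not the complex they generate: the result is again a set of
    facets, ready for [join1] and for another [bd]. *)
Definition bd (S : complex) : complex :=
  [fset r in generated S | deg S r == 1%N].

Lemma in_covertex S r x : (x \in covertex S r) = (x \notin r) && (x |` r \in S).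
Proof.
rewrite !inE /=; apply: andb_idl => /andP[_ xS].
by apply/bigfcupP; exists (x |` r); rewrite ?xS ?fset1U1.
Qed.

Lemma in_bd S r : (r \in bd S) = (deg S r == 1%N).
Proof.
rewrite !inE /=; apply: andb_idl => /cardfs1P[x xr].
have : x \in covertex S r by rewrite xr fset11.
rewrite in_covertex => /andP[_ xS]; apply/in_generated; exists (x |` r) => //.
exact: fsubsetU1.
Qed.

Lemma covertex_opp S r : covertex (opp_complex S) r = opp_face (covertex S (opp_face r)).
Proof.
apply/fsetP => x; rewrite in_opp_face !in_covertex in_opp_complex opp_faceU.
by rewrite in_opp_face opprK opp_face1.
Qed.

Lemma deg_opp S r : deg (opp_complex S) r = deg S (opp_face r).
Proof. by rewrite /deg covertex_opp card_opp_face. Qed.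

Lemma bd_opp S : bd (opp_complex S) = opp_complex (bd S).
Proof. by apply/fsetP => r; rewrite in_opp_complex !in_bd deg_opp. Qed.

Lemma degD S T r : T `<=` S -> deg (S `\` T) r = (deg S r - deg T r)%N.
Proof.
move=> /fsubsetP TS; rewrite /deg -cardfsDS; last first.
  by apply/fsubsetP => x; rewrite !in_covertex => /andP[-> /TS].
congr #|` _|; apply/fsetP => x; rewrite in_fsetD !in_covertex in_fsetD.
by case: (x \in r).
Qed.

Lemma degS S T r : T `<=` S -> (deg T r <= deg S r)%N.
Proof.
move=> /fsubsetP TS; apply/fsubset_leq_card/fsubsetP => x.
by rewrite !in_covertex => /andP[-> /TS].
Qed.

Lemma degU S T r : [disjoint S & T]%fset ->
  deg (S `|` T) r = (deg S r + deg T r)%N.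
Proof.
move=> /fdisjointP ST; rewrite /deg.
have -> : covertex (S `|` T) r = covertex S r `|` covertex T r.
  apply/fsetP => x; rewrite in_fsetU !in_covertex in_fsetU.
  by case: (x \in r).
rewrite -cardfsUI (_ : covertex S r `&` covertex T r = fset0) ?cardfs0 ?addn0 //.
apply/fsetP => x; rewrite in_fsetI !in_covertex inE.
by apply/negP => /andP[/andP[_ /ST/negP h] /andP[_ /h]].
Qed.

Lemma deg0 r : deg fset0 r = 0%N.
Proof. by apply/eqP; rewrite cardfs_eq0; apply/eqP/fsetP=> x; rewrite in_covertex !inE andbF. Qed.

Definition avoids (v : int) (S : complex) := forall F, F \in S -> v \notin F.

Lemma deg_join1 P v r : avoids v P ->
  deg (join1 P v) r = if v \in r then deg P (r `\ v) else (r \in P) : nat.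
Proof.
move=> vP; rewrite /deg; case: ifPn => vr.
  congr #|` _|; apply/fsetP => x; rewrite !in_covertex in_join1 !inE vr orbT /=.
  case: (eqVneq x v) => [->|xv] /=.
    rewrite vr /=; apply/esym/negbTE/negP=> /vP.
    by rewrite fset1U1.
  suff -> : (x |` r) `\ v = x |` (r `\ v) by [].
  apply/fsetP => y; rewrite !inE.
  by case: (eqVneq y v) => [->|] //=; rewrite eq_sym (negbTE xv).
case: (boolP (r \in P)) => rP /=.
  apply/eqP/cardfs1P; exists v; apply/fsetP => x.
  rewrite in_covertex in_join1 !inE (negbTE vr) orbF.
  case: (eqVneq x v) => [->|xv]; first by rewrite vr fsetU1K.
  by rewrite andbF.
apply/eqP; rewrite cardfs_eq0; apply/eqP/fsetP => x.
rewrite in_covertex in_join1 !inE (negbTE vr) orbF.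
case: (eqVneq v x) => [<-|_]; last by rewrite andbF.
by rewrite fsetU1K // (negbTE rP) !andbF.
Qed.

Lemma deg_avoids P v r : avoids v P -> v \in r -> deg P r = 0%N.
Proof.
move=> vP vr; apply/eqP; rewrite cardfs_eq0; apply/eqP/fsetP => x.
rewrite in_covertex !inE; apply/negbTE/negP => /andP[_ /vP].
by rewrite !inE vr orbT.
Qed.

(** The common shape of all facet sets in the recursion: cross-polytopes and balls have [R] empty, a
    sphere after a replacement has in [R] the facets that stay, and boundaries of balls take this
    shape by [bd_cones]. *)
Definition cones (R P Q : complex) (n : nat) : complex :=
  R `|` (join1 P n%:Z `|` join1 Q (- n%:Z)).

Definition wf (c n : nat) (S : complex) : Prop :=
  forall F, F \in S -> [/\ F `<=` V n, antipode_free F & #|` F| = c].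

Definition pseudo_closed (S : complex) : Prop :=
  forall r, (deg S r == 0%N) || (deg S r == 2%N).

Lemma in_cones R P Q n F : (F \in cones R P Q n) =
  [|| F \in R, (n%:Z \in F) && (F `\ n%:Z \in P)
    | (- n%:Z \in F) && (F `\ - n%:Z \in Q)].
Proof. by rewrite !in_fsetU !in_join1. Qed.

Lemma opp_complex0 : opp_complex fset0 = fset0.
Proof. by apply/fsetP => F; rewrite in_opp_complex !inE. Qed.

Lemma opp_cones R P Q n : opp_complex (cones R P Q n) =
  cones (opp_complex R) (opp_complex Q) (opp_complex P) n.
Proof.
by rewrite /cones !opp_complexU !opp_join1 opprK; congr (_ `|` _); rewrite fsetUC.
Qed.

Lemma conesS R P Q R' P' Q' n : R `<=` R' -> P `<=` P' -> Q `<=` Q' ->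
  cones R P Q n `<=` cones R' P' Q' n.
Proof. by move=> *; rewrite !fsetUSS ?join1S. Qed.

Lemma wf_avoids c n S (x : int) : wf c n S -> (n < `|x|)%N -> avoids x S.
Proof.
move=> wS nx F /wS[/fsubsetP FV _ _]; apply/negP => /FV.
by rewrite inV; lia.
Qed.

Lemma wf0 c n : wf c n fset0.
Proof. by move=> F; rewrite inE. Qed.

Lemma wf_opp c n S : wf c n S -> wf c n (opp_complex S).
Proof.
move=> wS F; rewrite in_opp_complex => /wS[FV Ff Fc]; split.
- by rewrite -opp_faceS opp_V.
- by rewrite -antipode_free_opp.
- by rewrite -Fc card_opp_face.
Qed.

Lemma wfS c n S T : T `<=` S -> wf c n S -> wf c n T.
Proof. by move=> /fsubsetP TS wS F /TS/wS. Qed.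

Lemma wfU c n S T : wf c n S -> wf c n T -> wf c n (S `|` T).
Proof. by move=> wS wT F; rewrite in_fsetU => /orP[/wS|/wT]. Qed.

Lemma wfV c m n S : (m <= n)%N -> wf c m S -> wf c n S.
Proof. by move=> mn wS F /wS[FV Ff Fc]; split=> //; apply: subV FV. Qed.

Lemma wf_join1 c n S (x : int) : (`|x| = n.+1)%N -> wf c n S ->
  wf c.+1 n.+1 (join1 S x).
Proof.
move=> xn wS F; rewrite in_join1 => /andP[xF] /wS[/fsubsetP FV] /antipode_freeP Ff Fc.
split.
- apply/fsubsetP => y yF; rewrite inV; case: (eqVneq y x) => [->|yx]; first lia.
  by have := FV y; rewrite in_fsetD1 yx yF inV => /(_ isT); lia.
- apply/antipode_freeP => y yF; apply/negP => oyF.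
  have h z : z \in F -> z != x -> (`|z| <= n)%N.
    by move=> zF zx; have := FV z; rewrite in_fsetD1 zx zF inV => /(_ isT); lia.
  have [yx|yx] := eqVneq y x; first by have := h _ oyF; rewrite yx; lia.
  have [oyx|oyx] := eqVneq (- y) x; first by have := h _ yF; lia.
  by have := Ff y; rewrite !inE yx oyx yF oyF => /(_ isT).
- by rewrite (cardfsD1 x) xF Fc.
Qed.

Lemma wf_cones c n R P Q : wf c.+1 n R -> wf c n P -> wf c n Q ->
  wf c.+1 n.+1 (cones R P Q n.+1).
Proof.
move=> wR wP wQ; apply: wfU; first exact: wfV wR.
by apply: wfU; apply: wf_join1 => //; lia.
Qed.

Lemma wf_bd c n S : wf c.+1 n S -> wf c n (bd S).
Proof.
move=> wS r; rewrite in_bd => /cardfs1P[x xr].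
have : x \in covertex S r by rewrite xr fset11.
rewrite in_covertex => /andP[xNr] /wS[rV rf rc]; split.
- exact: fsubset_trans (fsubsetU1 _ _) rV.
- exact: antipode_freeS (fsubsetU1 _ _) rf.
- by move: rc; rewrite cardfsU1 xNr => -[].
Qed.

Lemma cones_disjoint_R c n R P Q : wf c n R ->
  [disjoint R & join1 P n.+1%:Z `|` join1 Q (- n.+1%:Z)]%fset.
Proof.
move=> wR; apply/fdisjointP => F FR; rewrite in_fsetU !in_join1.
by rewrite !(negbTE (wf_avoids wR _ FR)) //; lia.
Qed.

Lemma cones_disjoint_PQ c n P Q : wf c n Q ->
  [disjoint join1 P n.+1%:Z & join1 Q (- n.+1%:Z)]%fset.
Proof.
move=> wQ; apply/fdisjointP => F; rewrite !in_join1 => /andP[nF _].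
apply/negP => /andP[_ /(wf_avoids wQ)] /(_ n.+1%:Z).
by rewrite !inE nF andbT negbK eq_sym; lia.
Qed.

Lemma deg_outside e n S x r : wf e n S -> (`|x| = n.+1)%N -> x \in r ->
  ((deg S r = 0%N) * ((r \in S) = false))%type.
Proof.
move=> wS xn xr; have h : avoids x S by apply: wf_avoids wS _; lia.
by rewrite (deg_avoids h xr); split=> //; apply/negP => /h; rewrite xr.
Qed.

Lemma deg_cones c n R P Q r : wf c.+1 n R -> wf c n P -> wf c n Q ->
  deg (cones R P Q n.+1) r =
  if n.+1%:Z \in r then deg P (r `\ n.+1%:Z) else
  if - n.+1%:Z \in r then deg Q (r `\ - n.+1%:Z) else
  (deg R r + (r \in P) + (r \in Q))%N.
Proof.
move=> wR wP wQ; rewrite degU; last exact: cones_disjoint_R wR.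
rewrite degU; last exact: cones_disjoint_PQ wQ.
rewrite !deg_join1; [|apply: wf_avoids wQ _; lia|apply: wf_avoids wP _; lia].
case: ifPn => [nr|_].
  rewrite (deg_outside wR _ nr) // (deg_outside wQ _ nr) //.
  case: ifPn => [onr|_]; last by rewrite addn0.
  rewrite (@deg_avoids Q n.+1%:Z) ?addn0 //.
    by apply: wf_avoids wQ _; lia.
  by rewrite !inE nr andbT; lia.
case: ifPn => [onr|_]; last by rewrite addnA.
by rewrite (deg_outside wR _ onr) ?abszN // (deg_outside wP _ onr) ?abszN.
Qed.

(** A ridge through an apex has the degree of its trace in the base. A ridge without apex has degree
    [(r \in P) + (r \in Q)], and as [Q] lies in [P] this is one exactly on the difference. *)
Lemma bd_cones c n P Q : wf c n P -> wf c n Q -> Q `<=` P ->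
  bd (cones fset0 P Q n.+1) = cones (P `\` Q) (bd P) (bd Q) n.+1.
Proof.
move=> wP wQ /fsubsetP QP; apply/fsetP => r; rewrite in_bd in_cones.
rewrite (deg_cones _ (@wf0 _ _) wP wQ) deg0 !in_bd.
rewrite in_fsetD; case: ifPn => [nr|nr].
  rewrite (deg_outside wP _ nr) // andbF /=; case: (- n.+1%:Z \in r) => //=.
    rewrite [in deg Q _](@deg_avoids Q n.+1%:Z) ?orbF //.
      by apply: wf_avoids wQ _; lia.
    by rewrite !inE nr andbT; lia.
  by rewrite orbF.
case: ifPn => [onr|onr /=]; first by rewrite (deg_outside wP _ onr) ?abszN // andbF.
rewrite orbF; case: (boolP (r \in Q)) => [/QP ->|_] //.
by case: (r \in P).
Qed.

Lemma cones_disjoint c n P Q P' Q' : wf c n P -> wf c n Q -> wf c n P' -> wf c n Q' ->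
  [disjoint P & P']%fset -> [disjoint Q & Q']%fset ->
  [disjoint cones fset0 P Q n.+1 & cones fset0 P' Q' n.+1]%fset.
Proof.
move=> wP wQ wP' wQ' /fdisjointP PP /fdisjointP QQ; apply/fdisjointP => F.
rewrite !in_cones !in_fset0 /= => /orP[]/andP[nF FP]; apply/norP; split.
- by rewrite nF; apply: PP.
- apply/negP => /andP[_ /(wf_avoids wQ')] /(_ n.+1%:Z).
  by rewrite !inE nF andbT; lia.
- apply/negP => /andP[_ /(wf_avoids wP')] /(_ (- n.+1%:Z)).
  by rewrite !inE nF andbT; lia.
- by rewrite nF; apply: QQ.
Qed.

(** On an old ridge the step subtracts the degrees in [B] and in its antipode, and adds one for each
    of them that equals one. From degree 2 in [T], the pairs of degrees (0,0), (1,0), (0,1), (1,1)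
    lead back to 2, and (2,0), (0,2) lead to 0. A ridge through a new vertex only sees [bd B] or its
    antipode. *)
Lemma pseudo_closed_repl (T B : complex) c n : wf c.+1 n T -> wf c.+1 n B ->
  pseudo_closed T -> pseudo_closed (bd B) -> B `<=` T -> opp_complex B `<=` T ->
  [disjoint B & opp_complex B]%fset ->
  pseudo_closed (cones (T `\` (B `|` opp_complex B)) (bd B) (opp_complex (bd B)) n.+1).
Proof.
move=> wT wB pT pB BT oBT BB r.
have wb := wf_bd wB; rewrite (deg_cones _ _ wb (wf_opp wb)); last first.
  exact: wfS (fsubsetDl _ _) wT.
case: ifP => _; first exact: pB.
case: ifP => _; first by rewrite deg_opp; apply: pB.
have BoBT : B `|` opp_complex B `<=` T by rewrite fsubUset BT.
rewrite degD // degU // -bd_opp !in_bd; move: (pT r) (degS r BoBT).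
rewrite degU //; lia.
Qed.

(** By [bd_cones], an old ridge has degree deg P - deg Q, plus one for each of these two degrees
    that equals one; with deg Q <= deg P <= 2 every case gives 0 or 2. *)
Lemma pseudo_closed_bd_cones c n P Q : wf c.+1 n P -> wf c.+1 n Q -> Q `<=` P ->
  (forall r, (deg P r <= 2)%N) -> pseudo_closed (bd P) -> pseudo_closed (bd Q) ->
  pseudo_closed (bd (cones fset0 P Q n.+1)).
Proof.
move=> wP wQ QP P2 pP pQ r; rewrite (bd_cones wP wQ QP).
have wb := wf_bd wP; have wb' := wf_bd wQ.
rewrite (deg_cones _ _ wb wb'); last exact: wfS (fsubsetDl _ _) wP.
case: ifP => _; first exact: pP.
case: ifP => _; first exact: pQ.
rewrite degD // !in_bd; move: (P2 r) (degS r QP); lia.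
Qed.

(** * Facets of the spheres and of the balls *)

Fixpoint cross (m : nat) : complex :=
  if m is m'.+1 then cones fset0 (cross m') (cross m') m else [fset fset0].

Lemma wf_cross m : wf m m (cross m).
Proof.
elim: m => [F|m IHm] /=; last exact: (wf_cones (@wf0 _ _) IHm IHm).
rewrite inE => /eqP ->; split; rewrite ?cardfs0 ?fsub0set //.
by apply/antipode_freeP => x; rewrite inE.
Qed.

Lemma pseudo_closed_cross m : pseudo_closed (cross m).
Proof.
elim: m => [|m IHm] r /=.
  apply/orP; left; rewrite cardfs_eq0; apply/eqP/fsetP => x.
  rewrite in_covertex !inE; apply/negbTE/negP => /andP[_ /eqP/fsetP/(_ x)].
  by rewrite !inE eqxx.
have wc := @wf_cross m; rewrite (deg_cones _ (@wf0 _ _) wc wc) deg0.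
case: ifP => _; first exact: IHm.
case: ifP => _; first exact: IHm.
by case: (r \in _).
Qed.

Lemma opp_cross m : opp_complex (cross m) = cross m.
Proof.
elim: m => [|m IHm] /=; last by rewrite opp_cones IHm opp_complex0.
apply/fsetP => F; rewrite in_opp_complex !inE.
by rewrite -!cardfs_eq0 card_opp_face.
Qed.

Lemma antipode_freeD1_V (X : face) n : X `<=` V n.+1 -> antipode_free X ->
  n.+1%:Z \in X -> X `\ n.+1%:Z `<=` V n.
Proof.
move=> /fsubsetP XV /antipode_freeP Xf nX; apply/fsubsetP => x.
rewrite in_fsetD1 => /andP[xn xX]; have := XV _ xX; rewrite !inV.
have : x != - n.+1%:Z by apply/eqP => xe; have /negP := Xf _ nX; rewrite -xe.
by lia.
Qed.

Lemma antipode_freeD1_oV (X : face) n : X `<=` V n.+1 -> antipode_free X ->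
  - n.+1%:Z \in X -> X `\ - n.+1%:Z `<=` V n.
Proof.
move=> XV Xf nX; rewrite -opp_faceS opp_V opp_faceD opp_face1 opprK.
apply: antipode_freeD1_V; rewrite ?antipode_free_opp ?in_opp_face //.
by rewrite -opp_faceS opp_faceK opp_V.
Qed.

Lemma subV_pred (X : face) n : X `<=` V n.+1 -> n.+1%:Z \notin X ->
  - n.+1%:Z \notin X -> X `<=` V n.
Proof.
move=> /fsubsetP XV nX oX; apply/fsubsetP => x xX; have := XV _ xX.
have xn : x != n.+1%:Z by apply: contraNneq nX => <-.
have xo : x != - n.+1%:Z by apply: contraNneq oX => <-.
by rewrite !inV; lia.
Qed.

Lemma fsubD1 (X F : face) x : X `\ x `<=` F -> X `<=` x |` F.
Proof.
move=> /fsubsetP XF; apply/fsubsetP => y yX; rewrite !inE.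
by case: eqVneq => //= yx; apply: XF; rewrite !inE yx.
Qed.

Lemma generated_join1 (P : complex) X v : avoids v P ->
  X `\ v \in generated P -> X \in generated (join1 P v).
Proof.
move=> vP /in_generated[F FP XF]; apply/in_generated; exists (v |` F).
  by rewrite in_join1 fset1U1 fsetU1K ?vP.
exact: fsubD1.
Qed.

Lemma cross_face m (X : face) : X `<=` V m -> antipode_free X ->
  X \in generated (cross m).
Proof.
elim: m X => [|m IHm] X XV Xf.
  apply/in_generated; exists fset0; first by rewrite inE.
  by apply/fsubsetP => x /(fsubsetP XV); rewrite inV; lia.
have wc := @wf_cross m; rewrite /= !generatedU !in_fsetU.
have [nX|nX] := boolP (m.+1%:Z \in X).
  apply/orP; right; apply/orP; left; apply: generated_join1.
    by apply: wf_avoids wc _; lia.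
  apply: IHm; first exact: antipode_freeD1_V.
  exact: antipode_freeS (fsubsetDl _ _) Xf.
apply/orP; right; apply/orP; right; apply: generated_join1.
  by apply: wf_avoids wc _; lia.
apply: IHm; last exact: antipode_freeS (fsubsetDl _ _) Xf.
have [oX|oX] := boolP (- m.+1%:Z \in X); first exact: antipode_freeD1_oV.
by rewrite mem_fsetD1 //; apply: subV_pred.
Qed.

Lemma in_cross m F :
  (F \in cross m) = [&& F `<=` V m, antipode_free F & #|` F| == m].
Proof.
apply/idP/idP => [/wf_cross[-> -> ->]|/and3P[FV Ff /eqP Fm]].
  by rewrite eqxx.
have /in_generated[G Gc FG] := cross_face FV Ff.
suff -> : F = G by [].
have [_ _ Gm] := wf_cross Gc.
apply/eqP; rewrite eqEfcard FG Fm Gm.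
exact: leqnn.
Qed.

Definition repl (T B : complex) (n : nat) : complex :=
  cones (T `\` (B `|` opp_complex B)) (bd B) (opp_complex (bd B)) n.

Fixpoint sphereF_from (d : nat) (B : nat -> complex) (n : nat) : complex :=
  if n is m.+1 then
    if (d < m)%N then repl (sphereF_from d B m) (B m) m.+1 else cross d.+1
  else cross d.+1.

(* [ballF d j n] is the set of facets of B^{d,j-1}_n. The recursion starts in
   dimension 0, with B^{0,0} consisting of the vertex -1, whose cone with apex n
   is the edge B^{1,0}_n = {-1, n}. *)
Fixpoint ballF (d j n : nat) : complex :=
  if d is d'.+1 then
    let low j n :=
      cones fset0 (ballF d' j n.-1) (opp_complex (ballF d' j.-1 n.-1)) n in
    if (j <= (uphalf d').+1)%N then low j n
    else sphereF_from d (low (uphalf d)) n `\` low j.-1 n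
  else if j == 1%N then [fset [fset -1]] else fset0.

Definition sphereF (d n : nat) : complex := sphereF_from d (ballF d (uphalf d)) n.

(** The largest meaningful index of [ballF d]: in both parities i runs up to ceil(d/2), shifted here
    by one. It is also the last index that the cone recursion reaches in dimension [d.+1]. *)
Definition top_idx (d : nat) : nat := (uphalf d).+1.

Lemma ballF_low d j n : (j <= top_idx d)%N ->
  ballF d.+1 j n = cones fset0 (ballF d j n.-1) (opp_complex (ballF d j.-1 n.-1)) n.
Proof. by rewrite /top_idx => /= ->. Qed.

Lemma eq_sphereF_from d B B' : B =1 B' -> sphereF_from d B =1 sphereF_from d B'.
Proof. by move=> eB; elim=> [//|n IHn] /=; rewrite IHn eB. Qed.

Lemma ballF_top d n : ~~ odd d ->
  ballF d.+1 (top_idx d).+1 n = sphereF d.+1 n `\` ballF d.+1 (top_idx d) n.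
Proof.
move=> od; rewrite (ballF_low _ (leqnn _)) /sphereF /= /top_idx.
rewrite ltnn; congr (_ `\` _); apply: eq_sphereF_from => m.
by rewrite ifT //; lia.
Qed.

Lemma ballF0 d n : ballF d 0 n = fset0.
Proof.
elim: d n => [//|d IHd] n; rewrite ballF_low // !IHd.
by apply/fsetP => F; rewrite in_cones in_opp_complex !inE !andbF.
Qed.

Lemma sphereF_min d n : (n <= d.+1)%N -> sphereF d n = cross d.+1.
Proof. by rewrite /sphereF; case: n => [|n] //= nd; rewrite ltnNge -ltnS nd. Qed.

Lemma sphereF_succ d n : (d < n)%N ->
  sphereF d n.+1 = repl (sphereF d n) (ballF d (uphalf d) n) n.+1.
Proof. by rewrite /sphereF /= => ->. Qed.

(** The bound [r] is independent of [d] because in odd dimension the cone recursion gives all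
    indices but the last, which has to wait for the sphere. The field [bi_sub2] makes [bi_opp]
    inductive: at the positive apex, the antipode of B^{d+1,i} has base B^{d,i-1}, whereas
    B^{d+1,i+1} has base B^{d,i+1}. *)
Record ballInv (r d : nat) : Prop := BallInv {
  bi_wf : forall j n, (j <= r)%N -> (d < n)%N -> wf d.+1 n (ballF d j n);
  bi_disj : forall j n, (j < r)%N -> (d < n)%N ->
    [disjoint ballF d j n & ballF d j.+1 n]%fset;
  bi_opp : forall j n, (j < r)%N -> (d < n)%N ->
    opp_complex (ballF d j n) `<=` ballF d j.+1 n;
  bi_sub2 : forall j n, (j.+1 < r)%N -> (d < n)%N ->
    ballF d j n `<=` ballF d j.+2 n;
  bi_le2 : forall j n F, (j <= r)%N -> (d < n)%N -> (deg (ballF d j n) F <= 2)%N;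
  bi_pseudo_closed : forall j n, (j <= r)%N -> (d < n)%N -> pseudo_closed (bd (ballF d j n)) }.

Lemma ballInv_0 : ballInv 1 0.
Proof.
have cP (F : face) : (F == [fset -1]) = (F `\ -1 == fset0) && (-1 \in F).
  apply/eqP/andP => [->|[/eqP F0 F1]].
    by rewrite fset11; split=> //; rewrite fsetDv.
  by rewrite -(fsetD1K F1) F0 fsetU0.
have wf1 : wf 1 1 [fset [fset -1]].
  move=> F; rewrite inE => /eqP ->; split; rewrite ?cardfs1 //.
    by apply/fsubsetP => x; rewrite inE => /eqP ->; rewrite inV.
  by apply/antipode_freeP => x; rewrite !inE => /eqP ->.
have e1 : [fset [fset -1]] = join1 [fset fset0] (-1).
  by apply/fsetP => F; rewrite in_join1 !in_fset1 cP andbC.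
have av : avoids (-1) [fset fset0] by move=> F; rewrite inE => /eqP ->; rewrite inE.
have w0 := @wf_cross 0; rewrite /= in w0.
have c0 := @pseudo_closed_cross 0; rewrite /= in c0.
have le1 r : (deg [fset fset0] r = 0)%N.
  apply/eqP; rewrite cardfs_eq0; apply/eqP/fsetP => x.
  rewrite in_covertex !inE; apply/negbTE/negP => /andP[_ /eqP/fsetP/(_ x)].
  by rewrite !inE eqxx.
have deg1 r : deg [fset [fset -1]] r = (r == fset0) :> nat.
  rewrite e1 deg_join1 // le1 in_fset1.
  by case: ifP => //; case: eqP => // ->; rewrite inE.
have wfS0 c n : wf c n fset0 by apply: wf0.
split=> /=.
- move=> [|[|j]] n //= _ n0; exact: wfV n0 wf1.
- by move=> [|j] n //= _ n0; apply: fdisjoint0X.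
- by move=> [|j] n //= _ n0; rewrite opp_complex0 fsub0set.
- by [].
- by move=> [|[|j]] n F //= _ n0; rewrite ?deg0 ?deg1 //; case: eqP.
- move=> [|[|j]] n //= _ n0 r; apply/orP; left; rewrite cardfs_eq0;
    apply/eqP/fsetP => x; rewrite in_covertex in_bd ?deg0 ?andbF //.
  rewrite deg1 eqb1; apply/negbTE/negP => /andP[_ /eqP/fsetP/(_ x)].
  by rewrite !inE eqxx.
Qed.

Arguments ballF : simpl never.
Arguments cross : simpl never.

Lemma opp_complex_sub_opp (S T : complex) :
  (opp_complex S `<=` T) = (S `<=` opp_complex T).
Proof. by rewrite -opp_complexS opp_complexK. Qed.

Lemma ballInv_low d : ballInv (top_idx d) d -> ballInv (top_idx d) d.+1.
Proof.
move=> [wfd disj oppd sub2 le2 pmd].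
have wfo j n : (j <= top_idx d)%N -> (d < n)%N -> wf d.+1 n (opp_complex (ballF d j.-1 n)).
  by move=> jr dn; apply/wf_opp/wfd => //; lia.
have subP j n : (j <= top_idx d)%N -> (d < n)%N ->
    opp_complex (ballF d j.-1 n) `<=` ballF d j n.
  case: j => [|j] jr dn; first by rewrite ballF0 opp_complex0.
  exact: oppd.
split.
- move=> j [|n] // jr dn; rewrite ballF_low //=.
  by apply: wf_cones; [apply: wf0 | apply: wfd | apply: wfo].
- move=> j [|n] // jr dn; rewrite !ballF_low //=; last exact: ltnW.
  apply: (@cones_disjoint d.+1); [apply: wfd|apply: wfo|apply: wfd|apply: (wfo j.+1)| |] => //;
    try exact: ltnW; first exact: disj.
  case: j jr => [|j] jr; first by rewrite !ballF0 opp_complex0 fdisjoint0X.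
  apply/fdisjointP => F; rewrite !in_opp_complex /=; apply: fdisjointP.
  by apply: disj => //; lia.
- move=> j [|n] // jr dn; rewrite !ballF_low //=; last exact: ltnW.
  rewrite opp_cones opp_complex0 opp_complexK; apply: conesS => //.
  case: j jr => [|j] jr; first by rewrite ballF0 fsub0set.
  by apply: sub2 => //.
- move=> j [|n] // jr dn; rewrite !ballF_low //=; last by lia.
  apply: conesS => //; first exact: sub2.
  case: j jr => [|j] jr; first by rewrite ballF0 opp_complex0 fsub0set.
  by rewrite opp_complexS; apply: sub2 => //; lia.
- move=> j [|n] F // jr dn; rewrite !ballF_low //=.
  rewrite (deg_cones _ (@wf0 _ _) (wfd j n _ _) (wfo j n _ _)) // deg0 deg_opp.
  by case: ifP => _; [apply: le2 | case: ifP => _; [apply: le2 => //; lia |]];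
    do 2?case: (F \in _).
- move=> j [|n] // jr dn; rewrite !ballF_low //=.
  apply: (@pseudo_closed_bd_cones d); [apply: wfd|apply: wfo|apply: subP| |apply: pmd|] => //.
    by move=> r; apply: le2.
  move=> r; rewrite bd_opp deg_opp; apply: pmd => //; lia.
Qed.

(** Used to place the ball inside the next sphere: both consist of cones with apexes [n.+1] and
    [- n.+1], and these are the inclusions between their bases. *)
Definition bdSub (d : nat) : Prop := forall j n, (j <= top_idx d)%N -> (d.+1 < n)%N ->
  ballF d j n `<=` bd (ballF d.+1 j n) /\ ballF d j.-1 n `<=` bd (ballF d.+1 j n).

Record sphInv (d : nat) : Prop := SphInv {
  si_wf : forall n, (d < n)%N -> wf d.+1 n (sphereF d n);
  si_opp : forall n, (d < n)%N -> opp_complex (sphereF d n) = sphereF d n;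
  si_sub : forall n, (d < n)%N -> ballF d (uphalf d) n `<=` sphereF d n;
  si_disj : forall n, (d < n)%N ->
    [disjoint ballF d (uphalf d) n & opp_complex (ballF d (uphalf d) n)]%fset;
  si_pseudo_closed : forall n, (d < n)%N -> pseudo_closed (sphereF d n) }.

Lemma sub_cones R P Q R' P' Q' n (F : face) : F \in cones R P Q n ->
  (F \in R -> F \in cones R' P' Q' n) -> P `<=` P' -> Q `<=` Q' ->
  F \in cones R' P' Q' n.
Proof.
move=> + RR /fsubsetP PP /fsubsetP QQ.
rewrite in_cones => /or3P[/RR //|/andP[nF /PP FP]|/andP[nF /QQ FP]].
  by rewrite in_cones nF FP orbT.
by rewrite in_cones nF FP !orbT.
Qed.

Lemma sphInv_succ d : ~~ odd d -> ballInv (top_idx d) d -> bdSub d -> sphInv d.+1.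
Proof.
move=> od inv bs; have [wfd disj oppd sub2 le2 pmd] := ballInv_low inv.
have ud : uphalf d.+1 = top_idx d by rewrite /top_idx; lia.
have jr : (top_idx d <= top_idx d)%N by [].
have wfB n : (d.+1 < n)%N -> wf d.+2 n (ballF d.+1 (top_idx d) n) by apply: wfd.
have disB n : (d.+1 < n)%N ->
    [disjoint ballF d.+1 (top_idx d) n & opp_complex (ballF d.+1 (top_idx d) n)]%fset.
  case: n => // n dn; rewrite ballF_low //= opp_cones opp_complex0 opp_complexK.
  have w1 : wf d.+1 n (ballF d (top_idx d) n) by apply: (bi_wf inv).
  have w2 : wf d.+1 n (ballF d (top_idx d).-1 n) by apply: (bi_wf inv).
  have dj : [disjoint ballF d (top_idx d).-1 n & ballF d (top_idx d) n]%fset.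
    exact: (bi_disj inv).
  apply: (cones_disjoint w1 (wf_opp w2) w2 (wf_opp w1)); first by rewrite fdisjoint_sym.
  apply/fdisjointP => F; rewrite !in_opp_complex; exact: fdisjointP.
have wfT n : (d.+1 < n)%N -> wf d.+2 n (sphereF d.+1 n).
  elim: n => // n IHn dn; have [dn'|nd] := ltnP d.+1 n; last first.
    rewrite sphereF_min //; have -> : n.+1 = d.+2 by lia.
    exact: wf_cross.
  rewrite sphereF_succ // ud; apply: wf_cones; first exact: wfS (fsubsetDl _ _) (IHn _).
    exact/wf_bd/wfB.
  exact/wf_opp/wf_bd/wfB.
have oppT n : (d.+1 < n)%N -> opp_complex (sphereF d.+1 n) = sphereF d.+1 n.
  elim: n => // n IHn dn; have [dn'|nd] := ltnP d.+1 n; last first.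
    by rewrite sphereF_min //; apply: opp_cross.
  rewrite sphereF_succ // ud /repl opp_cones opp_complexD opp_complexU !opp_complexK IHn //.
  by congr (cones (_ `\` _) _ _ _); rewrite fsetUC.
have subT n : (d.+1 < n)%N -> ballF d.+1 (top_idx d) n `<=` sphereF d.+1 n.
  case: n => // n dn; have [dn'|nd] := ltnP d.+1 n; last first.
    rewrite sphereF_min //; apply/fsubsetP => F.
    have en : n.+1 = d.+2 by lia.
    rewrite en in_cross => /wfB => /(_ (ltnSn _))[-> -> ->]; exact: eqxx.
  have [s1 s2] := bs _ _ jr dn'.
  apply/fsubsetP => F; rewrite ballF_low //= sphereF_succ // ud => h.
  apply: (sub_cones h) => //; rewrite opp_complexS //.
split=> [//|//| | |]; rewrite ?ud //.
elim=> // n IHn dn; have [dn'|nd] := ltnP d.+1 n; last first.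
  by rewrite sphereF_min //; apply: pseudo_closed_cross.
rewrite sphereF_succ // ud; apply: (pseudo_closed_repl (c := d.+1)); rewrite ?disB ?subT //.
- exact: wfT.
- exact: wfB.
- exact: IHn.
- exact: pmd.
- by rewrite -(oppT n) // opp_complexS subT.
Qed.

(** The degrees of a ridge in the ball and in its complement add up to 0 or 2, so one of them is 1
    exactly when the other is. *)
Lemma bd_sphD d n : sphInv d -> (d < n)%N ->
  bd (sphereF d n `\` ballF d (uphalf d) n) = bd (ballF d (uphalf d) n).
Proof.
move=> inv dn; apply/fsetP => r; rewrite !in_bd degD; last exact: si_sub.
have := degS r (si_sub inv dn); have := si_pseudo_closed inv dn r; lia.
Qed.

(** The complement of B in the sphere contains -B, since the sphere is invariant and B, -B share no
    facet. This is [bi_opp] at the new index; preceded by [bi_opp] one index lower it gives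
    [bi_sub2]. The boundary is that of B by [bd_sphD]. *)
Lemma ballInv_top d : ~~ odd d -> ballInv (top_idx d) d -> sphInv d.+1 ->
  ballInv (top_idx d).+1 d.+1.
Proof.
move=> od /ballInv_low [wfd disj oppd sub2 le2 pmd] inv.
have ud : uphalf d.+1 = top_idx d by rewrite /top_idx; lia.
have oppT n : (d.+1 < n)%N -> opp_complex (ballF d.+1 (top_idx d) n) `<=` sphereF d.+1 n.
  by move=> dn; rewrite -(si_opp inv) // opp_complexS -ud si_sub.
have wT n : (d.+1 < n)%N -> wf d.+2 n (ballF d.+1 (top_idx d).+1 n).
  by move=> dn; rewrite ballF_top //; apply: wfS (fsubsetDl _ _) (si_wf inv dn).
have subT n S : (d.+1 < n)%N -> S `<=` opp_complex (ballF d.+1 (top_idx d) n) ->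
    S `<=` ballF d.+1 (top_idx d).+1 n.
  move=> dn SB; rewrite ballF_top //; apply/fsubsetP => F /(fsubsetP SB) FB.
  rewrite in_fsetD (fsubsetP (oppT _ dn)) // andbT; apply/negP => FB'.
  have := si_disj inv dn; rewrite ud => /fdisjointP/(_ _ FB').
  by rewrite FB.
split.
- move=> j n; rewrite leq_eqVlt => /orP[/eqP ->|jr]; [exact: wT | exact: wfd].
- move=> j n; rewrite ltnS leq_eqVlt => /orP[/eqP ->|jr]; last exact: disj.
  move=> dn; rewrite ballF_top //; apply/fdisjointP => F FB.
  by rewrite in_fsetD FB.
- move=> j n; rewrite ltnS leq_eqVlt => /orP[/eqP ->|jr]; last exact: oppd.
  by move=> dn; apply: subT.
- move=> j n; rewrite ltnS leq_eqVlt => /orP[/eqP jr|jr]; last exact: sub2.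
  move=> dn; rewrite jr; apply: subT => //.
  by rewrite -jr -opp_complex_sub_opp; apply: oppd => //; lia.
- move=> j n F; rewrite leq_eqVlt => /orP[/eqP ->|jr]; last exact: le2.
  move=> dn; rewrite ballF_top //; apply: leq_trans (degS F (fsubsetDl _ _)) _.
  have := si_pseudo_closed inv dn F; lia.
- move=> j n; rewrite leq_eqVlt => /orP[/eqP ->|jr]; last exact: pmd.
  move=> dn; rewrite ballF_top // -ud bd_sphD // ud; exact: pmd.
Qed.

(** Let S be the sphere one vertex pair earlier and B its ball. The two cones of the ball have bases
    S minus B and -B, so by [bd_cones] the boundary consists of S without B and -B, together with
    the cones over [bd B] and its antipode: this is the replacement step that yields the next
    sphere. *)
Lemma bd_ballF_top d n : odd d -> ballInv (top_idx d) d -> sphInv d -> (d.+1 < n)%N ->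
  bd (ballF d.+1 (top_idx d) n) = sphereF d n.
Proof.
move=> od inv si; case: n => // n dn.
have ud : top_idx d = (uphalf d).+1 by [].
rewrite ballF_low //=.
have s : opp_complex (ballF d (uphalf d) n) `<=` ballF d (top_idx d) n by apply: (bi_opp inv).
have w1 : wf d.+1 n (ballF d (top_idx d) n) by apply: (bi_wf inv).
have w2 : wf d.+1 n (ballF d (uphalf d) n) by apply: (bi_wf inv) => //; lia.
rewrite (bd_cones w1 (wf_opp w2) s).
have -> : ballF d (top_idx d) n = sphereF d n `\` ballF d (uphalf d) n.
  have -> : d = d.-1.+1 by lia.
  rewrite [uphalf d.-1.+1](_ : _ = top_idx d.-1); last by rewrite /top_idx; lia.
  rewrite -ballF_top; last by lia.
  by congr (ballF _ _ _); rewrite /top_idx; lia.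
by rewrite bd_sphD // bd_opp sphereF_succ // /repl fsetDDl.
Qed.

Lemma bdSub0 : bdSub 0.
Proof.
move=> [|[|j]] n // _ n1.
split; last by rewrite ballF0 fsub0set.
apply/fsubsetP => F; rewrite in_fset1 => /eqP ->; case: n n1 => // n n1; rewrite ballF_low //=.
have w1 : wf 1 n [fset [fset -1]].
  by have := @bi_wf _ _ ballInv_0 1 n isT; apply.
rewrite ballF0 opp_complex0 (_ : ballF 0 1 n = [fset [fset -1]]) //.
rewrite (bd_cones w1 (@wf0 _ _) (fsub0set _)) in_cones in_fsetD.
by rewrite !inE eqxx.
Qed.

Lemma bdSub_succ d : ballInv (top_idx d) d -> ballInv (top_idx d.+1) d.+1 ->
  (odd d.+1 -> sphInv d.+1) -> bdSub d -> bdSub d.+1.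
Proof.
move=> inv0 inv si bs j n jr dn.
(* An index above [top_idx d] exists only for odd [d.+1]. There the boundary is the whole sphere of
   dimension [d.+1], which contains both the ball and its complement. *)
have jr' : (j <= top_idx d)%N \/ (odd d.+1 /\ j = top_idx d.+1).
  by move: jr; rewrite /top_idx; lia.
case: jr' => [jd|[od ->]]; last first.
  have si' := si od; rewrite bd_ballF_top //; split.
    have -> : top_idx d.+1 = (top_idx d).+1 by rewrite /top_idx; lia.
    by rewrite ballF_top; [apply: fsubsetDl | lia].
  by apply: (si_sub si'); lia.
case: n dn => // n dn.
have jr1 : (j.-1 <= top_idx d)%N by lia.
rewrite [ballF d.+2 j _]ballF_low //= (bd_cones (c := d.+2)); first last.
- case: j jr {jd jr1} => [|j] jr; first by rewrite ballF0 opp_complex0.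
  by apply: (bi_opp inv); lia.
- by apply/wf_opp/(bi_wf inv); lia.
- by apply: (bi_wf inv); lia.
have [a1 a2] := bs j n jd dn; have [b1 b2] := bs j.-1 n jr1 dn.
rewrite [ballF _ j n.+1]ballF_low // [ballF _ j.-1 n.+1]ballF_low //= bd_opp.
by split; apply: conesS; rewrite ?fsub0set ?opp_complexS.
Qed.

Lemma all_inv d : [/\ ballInv (top_idx d) d, bdSub d & (odd d -> sphInv d)].
Proof.
elim: d => [|d [inv bs si]].
  by split=> //; [exact: ballInv_0 | exact: bdSub0].
have si' : odd d.+1 -> sphInv d.+1.
  by move=> od; apply: sphInv_succ => //; lia.
have inv' : ballInv (top_idx d.+1) d.+1.
  have [od|od] := boolP (odd d).
    have -> : top_idx d.+1 = top_idx d by rewrite /top_idx; lia.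
    exact: ballInv_low.
  have -> : top_idx d.+1 = (top_idx d).+1 by rewrite /top_idx; lia.
  by apply: ballInv_top => //; apply: si'; rewrite /= od.
by split=> //; apply: bdSub_succ.
Qed.

(** * Comparison with the recursive definition *)

Definition pure (c : nat) (S : complex) : Prop := forall F, F \in S -> #|` F| = c.

Lemma wf_pure c n S : wf c n S -> pure c S.
Proof. by move=> wS F /wS[]. Qed.

Lemma mem_generated c S (F : face) : pure c S -> #|` F| = c ->
  (F \in generated S) = (F \in S).
Proof.
move=> pS Fc; apply/in_generated/idP => [[G GS FG]|FS]; last by exists F.
have /eqP -> // : F == G by rewrite eqEfcard FG Fc (pS _ GS) leqnn.
Qed.

Lemma facets_generated c S : pure c S -> facets (generated S) = S.
Proof.
move=> pS; apply/fsetP => F; rewrite /facets !inE /=.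
apply/andP/idP => [[/in_generated[G GS FG] /eqP/fsetP h]|FS].
  have := h G; rewrite !inE /= (mem_generated pS (pS _ GS)) GS /=.
  by move=> /negbT; rewrite fproperEneq FG andbT negbK => /eqP ->.
split; first by rewrite (mem_generated pS (pS _ FS)).
apply/eqP/fsetP => G; rewrite !inE /=; apply/negP => /andP[/in_generated[H HS GH]].
move=> /fproper_ltn_card; rewrite (pS _ FS) ltnNge -(pS _ HS).
by rewrite fsubset_leq_card.
Qed.

Lemma cdiff_generated c S T : pure c S -> pure c T ->
  cdiff (generated S) (generated T) = generated (S `\` T).
Proof.
move=> pS pT; rewrite /cdiff (facets_generated pS).
congr generated; apply/fsetP => F; rewrite !inE andbC /=.
by case: (boolP (F \in S)) => FS; rewrite ?andbF ?andbT // (mem_generated pT (pS _ FS)).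
Qed.

Lemma boundary_generated c S : pure c S ->
  boundary (generated S) = generated (bd S).
Proof.
move=> pS; rewrite /boundary (facets_generated pS).
congr generated; apply/fsetP => s; rewrite /bd !inE /=.
congr (_ && (_ == _)); rewrite /deg.
(* [deg] counts vertices and [boundary] counts facets; adding the vertex to [s] is the bijection
   between them. *)
have /eqP <- : #|` [fset x |` s | x in covertex S s]| == #|` covertex S s|.
  apply/card_in_imfsetP => x y; rewrite !in_covertex => /andP[xs _] /andP[ys _].
  by move=> /fsetP/(_ x); rewrite !inE eqxx (negbTE xs) /= orbF => /esym/eqP.
congr #|` _|; apply/fsetP => F; rewrite !inE /=.
apply/andP/imfsetP => [[FS /andP[sF /eqP Fs]]|[x /=]].
  have /cardfs1P[x Fx] : #|` F `\` s| == 1%N by rewrite cardfsDS // Fs subSnn.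
  have Fe : F = x |` s.
    by rewrite -Fx fsetUDr fsetDv fsetD0; apply/esym/fsetUidPl.
  exists x => //=; rewrite in_covertex -Fe FS andbT.
  by have := fset11 x; rewrite -Fx in_fsetD => /andP[].
rewrite in_covertex => /andP[xs xS] ->; split=> //.
by rewrite fsubsetU1 cardfsU1 xs eqxx.
Qed.

Lemma cone_generated P v : avoids v P ->
  cone (generated P) v = generated (join1 P v).
Proof.
move=> vP; apply/fsetP => X; apply/imfset2P/idP => [[s /= sP [t /=]]|XP].
  rewrite fpowersetE => tv ->; apply: generated_join1 => //.
  apply: generated_sub sP; apply/fsubsetP => x; rewrite !inE => /andP[xv].
  case/orP=> // /(fsubsetP tv); by rewrite inE (negbTE xv).
exists (X `\ v) => /=.
  move/in_generated: XP => [F]; rewrite in_join1 => /andP[vF FP] XF.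
  by apply/in_generated; exists (F `\ v) => //; apply: fsetSD.
exists (X `&` [fset v]); first by rewrite /= fpowersetE fsubsetIr.
by rewrite fsetUC fsetID.
Qed.

Lemma replace_balls_generated c n T B : wf c.+1 n T -> wf c.+1 n B ->
  replace_balls (generated T) (generated B) n.+1%:Z = generated (repl T B n.+1).
Proof.
move=> wT wB; have wb := wf_bd wB; have wbo := wf_bd (wf_opp wB).
rewrite /replace_balls -!generated_opp -generatedU.
rewrite (cdiff_generated (wf_pure wT) (wf_pure (wfU wB (wf_opp wB)))).
rewrite (boundary_generated (wf_pure wB)).
rewrite (boundary_generated (wf_pure (wf_opp wB))).
rewrite !cone_generated; [|apply: wf_avoids wbo _; lia|apply: wf_avoids wb _; lia].
by rewrite -!generatedU /repl /cones bd_opp fsetUA.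
Qed.

Lemma cross_bd_generated m : cross_bd m = generated (cross m).
Proof.
apply/fsetP => X; rewrite !inE /= fpowersetE; apply/andP/idP => [[]|].
  exact: cross_face.
move/in_generated => [F /wf_cross[FV Ff _] XF].
by split; [apply: fsubset_trans FV | apply: antipode_freeS Ff].
Qed.

Lemma in_join1_1 (G F : face) v : v \notin G ->
  (F \in join1 [fset G] v) = (F == v |` G).
Proof.
move=> vG; rewrite in_join1 in_fset1; apply/andP/eqP => [[vF /eqP <-]|->].
  by rewrite fsetD1K.
by rewrite fset1U1 fsetU1K.
Qed.

Definition cycle_succ (n : nat) (a : int) : int :=
  if 0 < a then if a < n%:Z then (a + 1)%R else -1
  else if - n%:Z < a then a - 1 else 1.

Ltac cycle_lia := rewrite /cycle_succ; do ?case: ifP => ?; lia.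

Lemma ballF1E n F : (1 < n)%N -> (F \in ballF 1 1 n) = (F == [fset n%:Z; -1]).
Proof.
move=> n1; rewrite ballF_low // ballF0 opp_complex0 in_cones in_fset0 /= in_fset0 andbF.
rewrite orbF -in_join1 in_join1_1 // inE; lia.
Qed.

Lemma in_bd_ballF1 n F : (1 < n)%N ->
  (F \in bd (ballF 1 1 n)) = (F == [fset n%:Z]) || (F == [fset -1]).
Proof.
case: n => // n n1; rewrite ballF_low // ballF0 opp_complex0.
have [inv _ _] := all_inv 0.
have w1 : wf 1 n (ballF 0 1 n) by apply: (bi_wf inv).
rewrite (bd_cones w1 (@wf0 _ _) (fsub0set _)) in_cones in_fsetD /=.
have cE r : (r \in bd (ballF 0 1 n)) = (r == fset0).
  rewrite in_bd /deg; apply/cardfs1P/eqP => [[x xr]|->].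
    have : x \in covertex (ballF 0 1 n) r by rewrite xr fset11.
    rewrite in_covertex inE => /andP[xNr /eqP e].
    apply/fsetP => y; rewrite in_fset0; apply/negP => yr.
    have: y \in x |` r by rewrite !inE yr orbT.
    rewrite e inE => /eqP y1; have: x \in x |` r by rewrite fset1U1.
    by rewrite e inE -y1 => /eqP xy; rewrite xy yr in xNr.
  exists (-1); apply/fsetP => x; rewrite in_covertex !inE /= fsetU0.
  by apply/eqP/eqP => [/fset1_inj|->].
have -> : bd fset0 = fset0 by apply/fsetP => r; rewrite in_bd deg0.
rewrite !in_fset0 andbF orbF cE -in_fset1 -in_join1 in_join1_1 ?inE //.
by rewrite fsetU0 orbC.
Qed.

Lemma in_cross1 F : (F \in cross 1) = (F == [fset 1]) || (F == [fset -1]).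
Proof.
rewrite /cross /cones !in_fsetU in_fset0 !in_join1_1 ?inE //.
by rewrite !fsetU0.
Qed.

(** [Delta] is given as a cycle in dimension one, while [sphereF 1] arises from the 4-cycle by
    replacements. Both agree, as each step replaces the edge {n, -1} by the path n, n+1, -1 and does
    the same at the antipode. *)
Lemma sphereF1P n F : (1 < n)%N ->
  F \in sphereF 1 n <-> exists2 a, a \in V n & F = [fset a; cycle_succ n a].
Proof.
elim: n F => // n IHn F; rewrite ltnS leq_eqVlt => /orP[/eqP <-|n1].
  rewrite sphereF_min // (_ : cross 2 = cones fset0 (cross 1) (cross 1) 2) //.
  rewrite in_cones in_fset0 /= !in_cross1.
  split=> [|[a]].
    case/orP=> /andP[nF /orP[]/eqP e]; rewrite -(fsetD1K nF) e.
    - by exists 1 => //; rewrite ?inV // fsetUC.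
    - by exists 2 => //; rewrite ?inV.
    - by exists (-2) => //; rewrite ?inV.
    - by exists (-1) => //; rewrite ?inV // fsetUC.
  rewrite inV => aV ->.
  have : a \in [:: 1; 2; -1; -2] by rewrite !inE; lia.
  rewrite !inE => /or4P[]/eqP ->; rewrite /cycle_succ /=.
  - by rewrite [[fset 1; _]]fsetUC fsetU1K ?inE // !eqxx.
  - by rewrite fsetU1K ?inE // eqxx ?orbT.
  - by rewrite [[fset _; _ - 1]]fsetUC fsetU1K ?inE // !eqxx ?orbT.
  - by rewrite fsetU1K ?inE // eqxx ?orbT.
rewrite sphereF_succ // [uphalf 1]/= /repl in_cones -bd_opp.
rewrite in_fsetD in_fsetU in_opp_complex !ballF1E //.
have oE (x y : int) : (opp_face F == [fset x; y]) = (F == [fset - x; - y]).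
  by rewrite -(inj_eq (inv_inj opp_faceK)) opp_faceK opp_faceU !opp_face1.
rewrite oE opprK bd_opp in_opp_complex !in_bd_ballF1 //.
have oE1 (G : face) (x : int) : (opp_face G == [fset x]) = (G == [fset - x]).
  by rewrite -(inj_eq (inv_inj opp_faceK)) opp_faceK !opp_face1.
rewrite !oE1 opprK.
split=> [/or3P[/andP[/norP[FB FB'] /IHn]|/andP[nF]|/andP[nF]]|[a]].
- move=> /(_ n1)[a]; rewrite inV => aV Fe.
  exists a; first by rewrite inV; lia.
  rewrite Fe; congr [fset _; _].
  have an : a != n%:Z.
    by apply: contraNneq FB => an; rewrite Fe an; apply/eqP; congr [fset _; _]; cycle_lia.
  have an' : a != - n%:Z.
    by apply: contraNneq FB' => an'; rewrite Fe an'; apply/eqP; congr [fset _; _]; cycle_lia.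
  cycle_lia.
- case/orP=> /eqP e; rewrite -(fsetD1K nF) e.
    exists n%:Z; first by rewrite inV; lia.
    by rewrite fsetUC; congr [fset _; _]; cycle_lia.
  exists n.+1%:Z; first by rewrite inV; lia.
  by congr [fset _; _]; cycle_lia.
- case/orP=> /eqP e; rewrite -(fsetD1K nF) e.
    exists (- n%:Z); first by rewrite inV; lia.
    by rewrite fsetUC; congr [fset _; _]; cycle_lia.
  exists (- n.+1%:Z); first by rewrite inV; lia.
  by congr [fset _; _]; cycle_lia.
rewrite inV => aV Fe.
(* The edges leaving [a] with [|a| < n] are those that stay; the four remaining starting points give
   the edges at [n.+1] and [- n.+1]. *)
have [an|an] := ltnP `|a|%N n.
  apply/or3P; apply: Or31; apply/andP; split; last first.
    apply/IHn => //; exists a; first by rewrite inV; lia.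
    by rewrite Fe; congr [fset _; _]; cycle_lia.
  apply/norP; split; apply/eqP => /fsetP e.
    have := e n%:Z; have := e (-1); rewrite Fe !inE !eqxx ?orbT; cycle_lia.
  have := e (- n%:Z); have := e 1; rewrite Fe !inE !eqxx ?orbT; cycle_lia.
have H : [\/ a = n%:Z, a = n.+1%:Z, a = - n%:Z | a = - n.+1%:Z].
  by case: (ltrP 0 a) => a0; case: (eqVneq `|a|%N n) => ?;
    [apply: Or41|apply: Or42|apply: Or43|apply: Or44]; lia.
apply/or3P; case: H => ae.
- apply: Or32; have -> : F = [fset n.+1%:Z; n%:Z].
    by rewrite Fe ae fsetUC; congr [fset _; _]; cycle_lia.
  by rewrite fset1U1 fsetU1K ?eqxx // inE; lia.
- apply: Or32; have -> : F = [fset n.+1%:Z; -1].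
    by rewrite Fe ae; congr [fset _; _]; cycle_lia.
  by rewrite fset1U1 fsetU1K ?eqxx ?orbT // inE; lia.
- apply: Or33; have -> : F = [fset - n.+1%:Z; - n%:Z].
    by rewrite Fe ae fsetUC; congr [fset _; _]; cycle_lia.
  by rewrite fset1U1 fsetU1K ?eqxx // inE; lia.
- apply: Or33; have -> : F = [fset - n.+1%:Z; 1].
    by rewrite Fe ae; congr [fset _; _]; cycle_lia.
  by rewrite fset1U1 fsetU1K ?eqxx ?orbT // inE; lia.
Qed.

Lemma cycle_generated n : (1 < n)%N -> cycle_complex n = generated (sphereF 1 n).
Proof.
move=> n1; congr generated; apply/fsetP => F.
set s := _ ++ _.
have sE : size s = n.*2.+1 by rewrite !size_cat !size_map size_iota /=; lia.
have nE i : (i < n.*2.+1)%N -> nth 0 s i =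
    if (i < n)%N then i.+1%:Z else if (i < n.*2)%N then - (i - n).+1%:Z else 1.
  move=> i2; rewrite !nth_cat !size_map size_iota; case: ltnP => ni.
    by rewrite (nth_map 0%N) ?size_iota // nth_iota // add1n.
  case: ltnP => ni2.
    rewrite ifT; last by lia.
    by rewrite (nth_map 0%N) ?size_iota // nth_iota // add1n.
  rewrite ifF; last by lia.
  by have -> : (i - n - n = 0)%N by lia.
have zE : size (zip s (behead s)) = n.*2 by rewrite size_zip size_behead sE /=; lia.
have nzE i : (i < n.*2)%N ->
    nth (0, 0) (zip s (behead s)) i = (nth 0 s i, nth 0 s i.+1).
  by move=> i2; rewrite nth_zip_cond zE i2 nth_behead.
apply/imfsetP/idP => [[p /= /(nthP (0, 0))[i]]|/sphereF1P-/(_ n1)[a]].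
  rewrite zE => i2; rewrite nzE // !nE //; last by lia.
  move=> <- -> /=; apply/sphereF1P => //; case: ltnP => ni.
    exists i.+1%:Z; first by rewrite inV; lia.
    by congr [fset _; _]; cycle_lia.
  rewrite i2; exists (- (i - n).+1%:Z); first by rewrite inV; lia.
  by congr [fset _; _]; cycle_lia.
rewrite inV => aV ->.
have [a0|a0] := ltrP 0 a.
  exists (a, cycle_succ n a) => //=; apply/(nthP (0, 0)); exists `|a|%N.-1.
    by rewrite zE; lia.
  by rewrite nzE ?nE; [congr (_, _); cycle_lia|lia..].
exists (a, cycle_succ n a) => //=; apply/(nthP (0, 0)).
exists (`|a|%N.-1 + n)%N; first by rewrite zE; lia.
by rewrite nzE ?nE; [congr (_, _); cycle_lia|lia..].
Qed.

Arguments ball : simpl never.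
Arguments Delta_from : simpl never.

Lemma generated0 : generated fset0 = fset0.
Proof.
apply/fsetP => X; rewrite in_fset0; apply/negP => /in_generated[F].
by rewrite in_fset0.
Qed.

Lemma generated_top d n : odd d -> (d < n)%N ->
  Delta d n = generated (sphereF d n) ->
  ball d ((uphalf d)%:Z - 1) n = generated (ballF d (uphalf d) n) ->
  ball d (uphalf d)%:Z n = generated (ballF d (top_idx d) n).
Proof.
move=> od dn eD eB; have [inv _ /(_ od) si] := all_inv d.
have dE : (2 * uphalf d - 1 = d)%N by lia.
have := @ball_top (uphalf d) n; rewrite dE => ->; last by lia.
rewrite eD eB (cdiff_generated (wf_pure (si_wf si dn)) (c := d.+1)); last first.
  by apply/wf_pure/(bi_wf inv) => //; rewrite /top_idx.
congr generated.
have -> : ballF d (top_idx d) n = ballF d.-1.+1 (top_idx d.-1).+1 n.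
  by congr (ballF _ _ _); rewrite /top_idx; lia.
rewrite ballF_top; last by lia.
by congr (sphereF _ _ `\` ballF _ _ _); rewrite /top_idx; lia.
Qed.

(** The order within a dimension is forced: cone indices come from the dimension below, the sphere
    needs the ball of index [uphalf d], and the last index needs the sphere. Dimension one is
    treated apart because [ballF] starts one dimension below [ball]. *)
Lemma ball_generated d : (0 < d)%N ->
  (forall j n, (j <= top_idx d)%N -> (d < n)%N ->
     ball d (j%:Z - 1) n = generated (ballF d j n))
  /\ (odd d -> forall n, (d < n)%N -> Delta d n = generated (sphereF d n)).
Proof.
elim: d => // d IHd _; have [d0|d0] := posnP d.
  rewrite {IHd}d0.
  have D1 n : (1 < n)%N -> Delta 1 n = generated (sphereF 1 n).
    by move=> n1; rewrite Delta1 cycle_generated.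
  have B1 n : (1 < n)%N -> ball 1 0 n = generated (ballF 1 1 n).
    move=> n1; rewrite ball10; apply/fsetP => X; rewrite fpowersetE.
    apply/idP/in_generated => [h|[F]]; last first.
      by rewrite ballF1E // => /eqP ->; rewrite fsetUC.
    by exists [fset n%:Z; -1]; rewrite ?ballF1E // fsetUC.
  split=> // -[|[|[|j]]] n // _ n1.
  - by rewrite ballF0 generated0 ball_neg.
  - by rewrite B1.
  - by apply: (@generated_top 1) => //; [apply: D1 | apply: B1].
have {IHd} [IHb IHD] := IHd d0.
have [inv0 _ _] := all_inv d; have [inv _ si] := all_inv d.+1.
have lowE j n : (j <= top_idx d)%N -> (d.+1 < n)%N ->
    ball d.+1 (j%:Z - 1) n = generated (ballF d.+1 j n).
  case: j => [|j] jr; first by rewrite ballF0 generated0 ball_neg.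
  case: n => // n dn; rewrite ballF_low //=.
  have -> : j.+1%:Z - 1 = j%:Z by lia.
  rewrite ball_rec // /cones /= !generatedU generated0 fset0U.
  have -> : j%:Z = j.+1%:Z - 1 by lia.
  rewrite IHb; [|lia|lia].
  have -> : j.+1%:Z - 1 - 1 = j%:Z - 1 by lia.
  rewrite IHb; [|lia|lia].
  have w1 : wf d.+1 n (ballF d j.+1 n) by apply: (bi_wf inv0).
  have w2 : wf d.+1 n (opp_complex (ballF d j n)).
    by apply/wf_opp/(bi_wf inv0) => //; lia.
  rewrite -generated_opp !cone_generated //.
    by apply: wf_avoids w2 _; lia.
  by apply: wf_avoids w1 _; lia.
have [od|od] := boolP (odd d).
  by split=> [j n jr|]; [apply: lowE; move: jr; rewrite /top_idx; lia | rewrite /= od].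
have {}si := si od.
have ud : uphalf d.+1 = top_idx d by rewrite /top_idx; lia.
have DE n : (d.+1 < n)%N -> Delta d.+1 n = generated (sphereF d.+1 n).
  elim: n => // n IHn dn; have [dn'|nd] := ltnP d.+1 n; last first.
    have -> : n.+1 = d.+2 by lia.
    by rewrite Delta_min // sphereF_min // cross_bd_generated.
  rewrite Delta_succ // IHn // ud lowE // sphereF_succ // ud.
  apply: (@replace_balls_generated d.+1); first exact: si_wf.
  by apply: (bi_wf inv); rewrite /top_idx; lia.
split=> // j n jr dn.
have [jd|jd] := leqP j (top_idx d); first exact: lowE.
have -> : j = top_idx d.+1 by move: jr jd; rewrite /top_idx; lia.
have := @generated_top d.+1 n; rewrite ud => h.
have -> : (top_idx d.+1)%:Z - 1 = (top_idx d)%:Z by rewrite /top_idx; lia.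
by apply: h => //; [apply: DE | apply: lowE].
Qed.

Lemma Delta_generated d n : odd d -> (d < n)%N ->
  Delta d n = generated (sphereF d n).
Proof. by move=> od; apply: (ball_generated _).2 => //; case: d od. Qed.

Lemma in_generated_join1 P v X : avoids v P ->
  (X \in generated (join1 P v)) = (X `\ v \in generated P).
Proof.
move=> vP; apply/idP/idP => [/in_generated[F]|]; last exact: generated_join1.
rewrite in_join1 => /andP[vF FP] XF; apply/in_generated.
by exists (F `\ v) => //; apply: fsetSD.
Qed.

Lemma in_generated_cones c n R P Q X : wf c n P -> wf c n Q ->
  (X \in generated (cones R P Q n.+1)) = [|| X \in generated R,
     X `\ n.+1%:Z \in generated P | X `\ - n.+1%:Z \in generated Q].
Proof.
move=> wP wQ; rewrite /cones !generatedU !in_fsetU !in_generated_join1 //.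
  by apply: wf_avoids wQ _; lia.
by apply: wf_avoids wP _; lia.
Qed.

Lemma generated_wf c n S X : wf c n S -> X \in generated S ->
  X `<=` V n /\ antipode_free X.
Proof.
move=> wS /in_generated[F /wS[FV Ff _] XF].
by split; [apply: fsubset_trans FV | apply: antipode_freeS Ff].
Qed.

Lemma generated_avoids S v X : avoids v S -> X \in generated S -> v \notin X.
Proof.
move=> vS /in_generated[F /vS vF XF].
by apply: contraNN vF; apply: (fsubsetP XF).
Qed.

Lemma in_generated_opp S X :
  (X \in generated (opp_complex S)) = (opp_face X \in generated S).
Proof. by rewrite generated_opp in_opp_complex. Qed.

Lemma generated_bd S X : X \in generated (bd S) -> X \in generated S.
Proof.
move=> /in_generated[r]; rewrite !inE /= => /andP[rS _] Xr.
exact: generated_sub Xr rS.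
Qed.

(** * Neighborliness *)

Definition pair12 (X : face) : bool :=
  ([fset 1; 2] `<=` X) || ([fset -1; -2] `<=` X).

(* The discount of one for the pairs [{1, 2}] and [{-1, -2}] accounts for their
   links being one step more neighborly than the sphere itself. *)
Definition weight (X : face) : nat := (#|` X| - pair12 X)%N.

Lemma sub2E (x y : int) (X : face) : ([fset x; y] `<=` X) = (x \in X) && (y \in X).
Proof. by rewrite fsubUset !fsub1set. Qed.

Lemma weight_opp X : weight (opp_face X) = weight X.
Proof. by rewrite /weight card_opp_face /pair12 !sub2E !in_opp_face !opprK orbC. Qed.

Lemma weightD1 (X : face) x : x \in X -> (2 < `|x|)%N ->
  weight (X `\ x) = (weight X).-1.
Proof.
move=> xX x3; rewrite /weight [in RHS](cardfsD1 x) xX.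
have -> : pair12 (X `\ x) = pair12 X.
  rewrite /pair12 !sub2E !in_fsetD1.
  have h y : (`|y| <= 2)%N -> (y != x) = true by lia.
  by rewrite !h.
by case: (pair12 X); lia.
Qed.

Lemma weight_eq0 X : (weight X == 0%N) = (X == fset0).
Proof.
apply/idP/eqP => [|->]; last by rewrite /weight cardfs0.
rewrite /weight subn_eq0 => h; apply/cardfs0_eq/eqP; move: h.
have h2 (x y : int) : x != y -> [fset x; y] `<=` X -> (2 <= #|` X|)%N.
  by move=> xy /fsubset_leq_card; rewrite cardfs2 xy.
case: (boolP (pair12 X)) => [/orP[]|_]; last by rewrite leqn0.
  by move=> /h2; lia.
by move=> /h2; lia.
Qed.

Lemma weight_gt0 X x : x \in X -> (0 < weight X)%N.
Proof.
by move=> xX; rewrite lt0n weight_eq0; apply/eqP => e; rewrite e inE in xX.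
Qed.

(** For odd [d] and [j = uphalf d] the bound in [nb_bd] reads weight at most [uphalf d]: these are
    the sets that must survive the replacement of balls. *)
Record nbInv (r d : nat) : Prop := NbInv {
  nb_face : forall j n X, (j <= r)%N -> (d < n)%N -> X `<=` V n ->
    antipode_free X -> (weight X < j)%N -> X \in generated (ballF d j n);
  nb_bd : forall j n X, (j <= r)%N -> (d < n)%N ->
    X \in generated (ballF d j n) -> (weight X + j <= d.+1)%N ->
    X \in generated (bd (ballF d j n)) }.

Definition sphNb (d : nat) : Prop := forall n X, (d < n)%N -> X `<=` V n ->
  antipode_free X -> (weight X <= uphalf d)%N -> X \in generated (sphereF d n).

(** The induction starts in dimension one, not zero: [weightD1] needs the removed vertex to exceed 2
    in absolute value, and in the step from [d] this vertex is only known to be at least d + 2. *)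
Lemma nbInv_low1 : nbInv 1 1.
Proof.
split=> [[|[|j]] n X // _ n1 _ _|[|[|j]] n X // _ n1].
- rewrite ltnS leqn0 weight_eq0 => /eqP ->.
  by apply/in_generated; exists [fset n%:Z; -1]; rewrite ?ballF1E // fsub0set.
- by rewrite ballF0 generated0.
move=> /in_generated[F]; rewrite ballF1E // => /eqP -> XF wX.
have [nX|nX] := boolP (n%:Z \in X); last first.
  apply/in_generated; exists [fset -1]; first by rewrite in_bd_ballF1 // eqxx orbT.
  apply/fsubsetP => x xX; have := fsubsetP XF _ xX; rewrite !inE => /orP[/eqP e|//].
  by rewrite -e xX in nX.
have [oX|oX] := boolP (-1 \in X); last first.
  apply/in_generated; exists [fset n%:Z]; first by rewrite in_bd_ballF1 // eqxx.
  apply/fsubsetP => x xX; have := fsubsetP XF _ xX; rewrite !inE => /orP[//|/eqP e].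
  by rewrite -e xX in oX.
have e : X = [fset n%:Z; -1].
  by apply/eqP; rewrite eqEfsubset XF sub2E nX oX.
by move: wX; rewrite e /weight cardfs2 /pair12 !sub2E !inE; lia.
Qed.

Lemma nbInv_low d : (0 < d)%N -> nbInv (top_idx d) d -> nbInv (top_idx d) d.+1.
Proof.
move=> d0 [nf nb]; have [inv _ _] := all_inv d.
have wP j n : (j <= top_idx d)%N -> (d < n)%N -> wf d.+1 n (ballF d j n).
  by move=> jr dn; apply: (bi_wf inv).
have wQ j n : (j <= top_idx d)%N -> (d < n)%N -> wf d.+1 n (opp_complex (ballF d j.-1 n)).
  by move=> jr dn; apply/wf_opp/wP => //; lia.
split=> j [|n] X // jr dn.
  move=> XV Xf wX; rewrite ballF_low // (in_generated_cones _ _ (wP _ _ jr dn) (wQ _ _ jr dn)) /=.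
  have [nX|nX] := boolP (n.+1%:Z \in X).
    apply/orP; right; apply/orP; left; apply: nf => //.
    - exact: antipode_freeD1_V.
    - exact: antipode_freeS (fsubsetDl _ _) Xf.
    - by rewrite weightD1 //; lia.
  have [oX|oX] := boolP (- n.+1%:Z \in X).
    apply/orP; right; apply/orP; right; rewrite in_generated_opp; apply: nf => //.
    - lia.
    - by rewrite -opp_faceS opp_faceK opp_V; apply: antipode_freeD1_oV.
    - by rewrite antipode_free_opp; apply: antipode_freeS (fsubsetDl _ _) Xf.
    - by have := weight_gt0 oX; rewrite weight_opp weightD1 //; lia.
  apply/orP; right; apply/orP; left; rewrite mem_fsetD1 //; apply: nf => //.
  exact: subV_pred.
have sub : opp_complex (ballF d j.-1 n) `<=` ballF d j n.
  case: j jr => [|j] jr; first by rewrite ballF0 opp_complex0 fsub0set.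
  by apply: (bi_opp inv).
rewrite !ballF_low //= (bd_cones (wP _ _ jr dn) (wQ _ _ jr dn) sub).
have wbP := wf_bd (wP _ _ jr dn); have wbQ := wf_bd (wQ _ _ jr dn).
rewrite (in_generated_cones _ _ (wP _ _ jr dn) (wQ _ _ jr dn)) generated0 /=.
rewrite (in_generated_cones _ _ wbP wbQ) bd_opp !in_generated_opp => XS wX.
have avP x : (n < `|x|)%N -> avoids x (ballF d j n) := wf_avoids (wP _ _ jr dn).
have avQ x : (n < `|x|)%N -> avoids x (opp_complex (ballF d j.-1 n)).
  exact: wf_avoids (wQ _ _ jr dn).
have j1 : (j.-1 <= top_idx d)%N by lia.
have j0 Y : Y \in generated (ballF d j.-1 n) -> (0 < j)%N.
  by case: j {jr XS wX avP avQ j1 wbP wbQ sub} => //; rewrite ballF0 generated0.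
(* An apex in [X] takes away one unit of weight, which pays for the lost dimension; at the negative
   apex the index drops as well. *)
have [nX|nX] := boolP (n.+1%:Z \in X).
  apply/orP; right; apply/orP; left; case/orP: XS => XS.
    by have h := weight_gt0 nX; apply: nb => //; rewrite weightD1 //; lia.
  move: XS; rewrite -in_generated_opp => XS.
  have av := avQ n.+1%:Z (ltnSn n); have := generated_avoids av XS.
  by rewrite in_fsetD1 nX andbT; lia.
have [oX|oX] := boolP (- n.+1%:Z \in X).
  apply/orP; right; apply/orP; right; case/orP: XS => XS; last first.
    have h := j0 _ XS; have h' := weight_gt0 oX.
    by apply: nb => //; rewrite weight_opp weightD1 //; lia.
  have av := avP (- n.+1%:Z) (ltnSn n); have := generated_avoids av XS.
  by rewrite in_fsetD1 oX andbT; lia.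
move: XS; rewrite !mem_fsetD1 //.
(* Without apex there are two cases. If [X] is a face of the antipodal base, the index of that base
   is lower by one and its boundary contains [X]. Otherwise no facet over [X] lies in that base, so
   a facet of the positive base over [X] remains in the difference. *)
have [XQ _|XQ] := boolP (opp_face X \in generated (ballF d j.-1 n)).
  apply/orP; right; apply/orP; right; apply: nb => //.
  by rewrite weight_opp; have := j0 _ XQ; lia.
rewrite orbF => /in_generated[F FP XF]; apply/orP; left.
apply/in_generated; exists F => //; rewrite in_fsetD FP andbT.
apply: contraNN XQ; rewrite in_opp_complex => FQ.
by apply/in_generated; exists (opp_face F) => //; rewrite opp_faceS.
Qed.

Lemma sphNb_of_low d : odd d -> nbInv (uphalf d) d -> sphNb d.
Proof.
move=> od [nf nb]; have [inv _ /(_ od) si] := all_inv d.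
have wB n : (d < n)%N -> wf d.+1 n (ballF d (uphalf d) n).
  by move=> dn; apply: (bi_wf inv) => //; rewrite /top_idx.
have ballF_bd n X : (d < n)%N -> X `<=` V n -> antipode_free X ->
    (weight X < uphalf d)%N -> X \in generated (bd (ballF d (uphalf d) n)).
  by move=> dn XV Xf wX; apply: nb => //; [apply: nf | lia].
elim=> // n IHn X dn XV Xf wX; have [dn'|nd] := ltnP d n; last first.
  have nE : n.+1 = d.+1 by lia.
  by rewrite sphereF_min //; apply: cross_face; rewrite -?nE.
have n2 : (2 < n.+1)%N by case: d od dn' {IHn inv si dn wX nf nb wB ballF_bd} => // d _; lia.
have wbP := wf_bd (wB _ dn').
rewrite sphereF_succ // (in_generated_cones _ _ wbP (wf_opp wbP)) in_generated_opp.
have [nX|nX] := boolP (n.+1%:Z \in X).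
  apply/orP; right; apply/orP; left; apply: ballF_bd => //.
  - exact: antipode_freeD1_V.
  - exact: antipode_freeS (fsubsetDl _ _) Xf.
  - by have := weight_gt0 nX; rewrite weightD1 //; lia.
have [oX|oX] := boolP (- n.+1%:Z \in X).
  apply/orP; right; apply/orP; right; apply: ballF_bd => //.
  - by rewrite -opp_faceS opp_faceK opp_V; apply: antipode_freeD1_oV.
  - by rewrite antipode_free_opp; apply: antipode_freeS (fsubsetDl _ _) Xf.
  - by have := weight_gt0 oX; rewrite weight_opp weightD1 //; lia.
rewrite !mem_fsetD1 //.
have /in_generated[F FT XF] := IHn X dn' (subV_pred XV nX oX) Xf wX.
have [FB|FB] := boolP (F \in ballF d (uphalf d) n).
  apply/orP; right; apply/orP; left; apply: nb => //; last by lia.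
  by apply/in_generated; exists F.
have [FB'|FB'] := boolP (opp_face F \in ballF d (uphalf d) n).
  apply/orP; right; apply/orP; right; apply: nb => //; last by rewrite weight_opp; lia.
  by apply/in_generated; exists (opp_face F) => //; rewrite opp_faceS.
apply/orP; left; apply/in_generated; exists F => //.
by rewrite in_fsetD in_fsetU in_opp_complex (negbTE FB) (negbTE FB').
Qed.

(** If a facet of the sphere over [X] lies in the smaller ball, then [X] is light enough to be on
    its boundary, which the complement shares. For [nb_bd], the bound at the last index forces the
    weight below [top_idx d], so that [X] is also a face of the smaller ball. *)
Lemma nbInv_top d : ~~ odd d -> nbInv (top_idx d) d.+1 -> nbInv (top_idx d).+1 d.+1.
Proof.
move=> od low; have [nf nb] := low.
have ud : uphalf d.+1 = top_idx d by rewrite /top_idx; lia.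
have od' : odd d.+1 by [].
have nS : sphNb d.+1 by apply: sphNb_of_low => //; rewrite ud.
have [inv _ /(_ od') si] := all_inv d.+1.
have bdE n : (d.+1 < n)%N ->
    bd (ballF d.+1 (top_idx d).+1 n) = bd (ballF d.+1 (top_idx d) n).
  by move=> dn; rewrite ballF_top // -ud bd_sphD.
split=> j n X; rewrite leq_eqVlt => /orP[/eqP ->|jr]; try exact: nf; try exact: nb.
  move=> dn XV Xf wX.
  have wX' : (weight X <= uphalf d.+1)%N by rewrite ud.
  have /in_generated[F FT XF] := nS n X dn XV Xf wX'.
  have [FB|FB] := boolP (F \in ballF d.+1 (top_idx d) n).
    apply: generated_bd; rewrite bdE //; apply: nb => //; last by rewrite -ud; lia.
    by apply/in_generated; exists F.
  by apply/in_generated; exists F => //; rewrite ballF_top // in_fsetD FB.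
move=> dn XS wX; rewrite bdE //.
have [XV Xf] : X `<=` V n /\ antipode_free X.
  have w := bi_wf inv (j := (top_idx d).+1) (n := n).
  by apply: generated_wf XS; apply: w => //; rewrite /top_idx; lia.
apply: nb => //; last by lia.
by apply: nf => //; move: wX; rewrite -ud /=; lia.
Qed.

Lemma all_nbInv d : (0 < d)%N -> nbInv (top_idx d) d.
Proof.
elim: d => // d IHd _.
have low : nbInv (top_idx d) d.+1.
  have [->|d0] := posnP d; first exact: nbInv_low1.
  by apply: nbInv_low => //; apply: IHd.
have [od|od] := boolP (odd d).
  by have -> : top_idx d.+1 = top_idx d by rewrite /top_idx; lia.
have -> : top_idx d.+1 = (top_idx d).+1 by rewrite /top_idx; lia.
exact: nbInv_top.
Qed.

Lemma all_sphNb d : odd d -> sphNb d.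
Proof.
move=> od; apply: sphNb_of_low => //.
have d0 : (0 < d)%N by case: d od.
have [nf nb] := all_nbInv d0.
by split=> j n X jr; [apply: nf | apply: nb]; rewrite /top_idx; lia.
Qed.

(** * Links of edges *)

Definition swap12 (S : complex) : Prop := forall Y : face,
  [disjoint Y & V 2]%fset ->
  ([fset 1; 2] `|` Y \in S) = ([fset -1; -2] `|` Y \in S).

Lemma disjoint_opp_V (Y : face) n :
  [disjoint opp_face Y & V n]%fset = [disjoint Y & V n]%fset.
Proof.
apply/fdisjointP/fdisjointP => h x.
  move=> xY; have := h (- x); rewrite in_opp_face opprK => /(_ xY).
  by rewrite !inV abszN.
by rewrite in_opp_face => /h; rewrite !inV abszN.
Qed.

Lemma swap12_opp S : swap12 S -> swap12 (opp_complex S).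
Proof.
move=> sS Y dY; rewrite !in_opp_complex !opp_faceU !opp_face1 !opprK sS //.
by rewrite disjoint_opp_V.
Qed.

Lemma swap12D S T : swap12 S -> swap12 T -> swap12 (S `\` T).
Proof. by move=> sS sT Y dY; rewrite !in_fsetD sS ?sT. Qed.

Lemma swap12U S T : swap12 S -> swap12 T -> swap12 (S `|` T).
Proof. by move=> sS sT Y dY; rewrite !in_fsetU sS ?sT. Qed.

Lemma swap12_0 : swap12 fset0.
Proof. by move=> Y _; rewrite !in_fset0. Qed.

Lemma swap12_join1 P x : (2 < `|x|)%N -> swap12 P -> swap12 (join1 P x).
Proof.
move=> x3 sP Y dY; rewrite !in_join1.
have E (a b : int) : (`|a| <= 2)%N -> (`|b| <= 2)%N ->
    (x \in [fset a; b] `|` Y = (x \in Y)) *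
    (([fset a; b] `|` Y) `\ x = [fset a; b] `|` (Y `\ x)).
  move=> a2 b2; have xa : (x == a) = false by lia.
  have xb : (x == b) = false by lia.
  split; first by rewrite !inE xa xb.
  rewrite fsetDUl; congr (_ `|` _); apply: mem_fsetD1.
  by rewrite !inE xa xb.
rewrite !E // sP //; apply/fdisjointP => y; rewrite in_fsetD1 => /andP[_].
exact/fdisjointP.
Qed.

Lemma swap12_cones R P Q n : (2 < n)%N -> swap12 R -> swap12 P -> swap12 Q ->
  swap12 (cones R P Q n).
Proof.
by move=> n3 sR sP sQ; do !apply: swap12U => //; apply: swap12_join1; rewrite ?abszN.
Qed.

(** Covertices outside {1, 2, -1, -2} correspond by hypothesis. None of these four vertices is a
    covertex of either ridge: it would occur twice or create an antipodal pair. *)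
Lemma swap12_bd c n S : wf c n S -> swap12 S -> swap12 (bd S).
Proof.
move=> wS sS Y dY; rewrite !in_bd; congr (_ == _); congr #|` _|.
apply/fsetP => x; rewrite !in_covertex.
have Sf (r : face) y : y \in r -> - y \in r -> (r \in S) = false.
  by move=> yr oyr; apply/negP => /wS[_ /antipode_freeP/(_ _ yr)/negP].
have YV y : y \in V 2 -> (y \in Y) = false.
  by move=> yV; apply/negP => /(fdisjointP dY); rewrite yV.
have [xV|xV] := boolP (x \in V 2); last first.
  have E (a b : int) : (`|a| <= 2)%N -> (`|b| <= 2)%N -> (0 < `|a|)%N -> (0 < `|b|)%N ->
      (x \in [fset a; b] `|` Y = (x \in Y)) *
      (x |` ([fset a; b] `|` Y) = [fset a; b] `|` (x |` Y)).
    move=> a2 b2 a0 b0; split; last by rewrite fsetUCA.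
    have xa : (x == a) = false by apply: contraNF xV => /eqP ->; rewrite inV a0.
    have xb : (x == b) = false by apply: contraNF xV => /eqP ->; rewrite inV b0.
    by rewrite !inE xa xb.
  rewrite !E // sS //; apply/fdisjointP => y; rewrite in_fset1U => /orP[/eqP ->//|].
  exact/fdisjointP.
have : x \in [:: 1; 2; -1; -2] by move: xV; rewrite inV !inE; lia.
rewrite !inE => /or4P[]/eqP ->.
- by rewrite (@Sf (1 |` ([fset -1; -2] `|` Y)) 1) ?andbF ?inE.
- by rewrite (@Sf (2 |` ([fset -1; -2] `|` Y)) 2) ?andbF ?inE.
- by rewrite (@Sf (-1 |` ([fset 1; 2] `|` Y)) (-1)) ?andbF ?inE.
- by rewrite (@Sf (-2 |` ([fset 1; 2] `|` Y)) (-2)) ?andbF ?inE.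
Qed.

Lemma swap12_cross m : (1 < m)%N -> swap12 (cross m).
Proof.
elim: m => // m IHm; rewrite ltnS leq_eqVlt => /orP[/eqP <-|m1]; last first.
  by apply: (swap12_cones _ swap12_0 (IHm m1) (IHm m1)).
move=> Y dY; have [->|[y yY]] := fset_0Vmem Y; last first.
  have E (F : face) : F `|` Y \in cross 2 = false.
    apply/negP; rewrite in_cross => /andP[/fsubsetP/(_ y)].
    rewrite in_fsetU yY orbT => /(_ isT) yV _.
    by have := fdisjointP dY _ yY; rewrite yV.
  by rewrite !E.
have E (a b : int) : `|a|%N = 1%N -> `|b|%N = 2%N -> [fset a; b] \in cross 2.
  move=> a1 b2; rewrite in_cross cardfs2 sub2E !inV a1 b2 /= andbC.
  rewrite (_ : a != b); last by apply/eqP => e; rewrite e b2 in a1.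
  apply/antipode_freeP => x; rewrite !inE => /orP[]/eqP ->; lia.
by rewrite !fsetU0 !E.
Qed.

Lemma swap12_sphereF d n : odd d -> (d < n)%N ->
  (forall m, (d < m)%N -> swap12 (ballF d (uphalf d) m)) -> swap12 (sphereF d n).
Proof.
move=> od + sB; have [inv _ /(_ od) si] := all_inv d.
have d0 := odd_gt0 od.
elim: n => // n IHn dn; have [dn'|nd] := ltnP d n; last first.
  by rewrite sphereF_min //; apply: swap12_cross; lia.
rewrite sphereF_succ //.
have wB : wf d.+1 n (ballF d (uphalf d) n) by apply: (bi_wf inv) => //; rewrite /top_idx.
have sbd := swap12_bd wB (sB n dn').
apply: swap12_cones => //; [lia| |exact: swap12_opp].
apply: swap12D; first exact: IHn.
by apply: swap12U; [|apply: swap12_opp]; apply: sB.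
Qed.

Lemma swap12_ballF d : (0 < d)%N -> forall j n, (j <= top_idx d)%N -> (d < n)%N ->
  swap12 (ballF d j n).
Proof.
elim: d => // d IHd _.
have low j n : (j <= top_idx d)%N -> (d.+1 < n)%N -> swap12 (ballF d.+1 j n).
  have [->|d0] := posnP d.
    case: j => [|[|j]] // _ n1 Y _; first by rewrite !ballF0.
    rewrite !ballF1E //.
    (* The sign condition excludes the pair -1, 2, which is the facet itself when n = 2. *)
    have E (a b : int) : `|a|%N = 1%N -> `|b|%N = 2%N -> (0 < a) || (b < 0) ->
        ([fset a; b] `|` Y == [fset n%:Z; -1]) = false.
      move=> a1 b2 ab; apply/negP => /eqP/fsetP e; have := e a; have := e b.
      by rewrite !inE !eqxx !orbT; lia.
    by rewrite !E.
  case: n => // n jr dn; rewrite ballF_low //.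
  apply: swap12_cones; [lia|exact: swap12_0|exact: IHd|].
  by apply: swap12_opp; apply: IHd => //; lia.
have [od|od] := boolP (odd d).
  by have -> : top_idx d.+1 = top_idx d by rewrite /top_idx; lia.
have -> : top_idx d.+1 = (top_idx d).+1 by rewrite /top_idx; lia.
move=> j n; rewrite leq_eqVlt => /orP[/eqP ->|jr]; last exact: low.
move=> dn; rewrite ballF_top //; apply: swap12D; last exact: low.
apply: swap12_sphereF => // m dm; apply: low => //; rewrite /top_idx; lia.
Qed.

Lemma swap12_all d n : odd d -> (d < n)%N -> swap12 (sphereF d n).
Proof.
move=> od dn; apply: swap12_sphereF => // m dm.
by apply: (swap12_ballF (odd_gt0 od)); rewrite /top_idx.
Qed.

(** A facet over the given face is {1,2} together with some Y. The swap turns it into {-1,-2}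
    together with Y, and the antipode of that is {1,2} together with -Y, which contains -s. *)
Lemma link12_opp d n (s : face) : odd d -> (d < n)%N ->
  [disjoint s & [fset 1; 2]]%fset -> s `|` [fset 1; 2] \in generated (sphereF d n) ->
  opp_face s `|` [fset 1; 2] \in generated (sphereF d n).
Proof.
move=> od dn ds /in_generated[F FT]; rewrite fsubUset => /andP[sF eF].
have [_ _ /(_ od) si] := all_inv d.
have [_ /antipode_freeP Ff _] := si_wf si dn FT.
pose Y := F `\` [fset 1; 2].
have FE : F = [fset 1; 2] `|` Y.
  by rewrite -[LHS](fsetID [fset 1; 2]) (fsetIidPr eF).
have [F1 F2] : 1 \in F /\ 2 \in F.
  by split; apply: (fsubsetP eF); rewrite !inE.
have dY : [disjoint Y & V 2]%fset.
  apply/fdisjointP => x; rewrite in_fsetD => /andP[x12 xF].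
  rewrite inV; apply/negP => xV.
  have : [\/ x = 1, x = 2, x = -1 | x = -2].
    have : x \in [:: 1; 2; -1; -2] by rewrite !inE; lia.
    by rewrite !inE => /or4P[]/eqP ->; [apply: Or41|apply: Or42|apply: Or43|apply: Or44].
  move=> [] xe; rewrite xe in x12 xF.
  - by rewrite !inE in x12.
  - by rewrite !inE in x12.
  - by have := Ff _ F1; rewrite xF.
  - by have := Ff _ F2; rewrite xF.
have := FT; rewrite FE (swap12_all od dn dY) -[in X in _ -> X](si_opp si dn) => Y12.
apply/in_generated; exists (opp_face ([fset -1; -2] `|` Y)).
  by rewrite in_opp_complex opp_faceK.
rewrite opp_faceU opp_faceU !opp_face1 !opprK fsetUC fsetUS // opp_faceS.
apply/fsubsetP => x xs; rewrite in_fsetD (fsubsetP sF _ xs) andbT.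
exact: (fdisjointP ds).
Qed.

(** Facets through [m.+2] are cones over the boundary of a ball of dimension [d]; those of them that
    also pass through [m.+1] are cones over the boundary of the ball with the same index in the even
    dimension d - 1. There this index is the largest one, and [bd_ballF_top] identifies the boundary
    with a sphere. *)
Lemma sphereF_top2 d m (X : face) : odd d -> (2 < d)%N -> (d < m.+1)%N ->
  m.+1%:Z \in X -> m.+2%:Z \in X ->
  (X \in generated (sphereF d m.+2)) =
  (X `\ m.+2%:Z `\ m.+1%:Z \in generated (sphereF d.-2 m)).
Proof.
case: d => [|[|[|d]]] // od _ dm X1 X2.
rewrite [d.+3.-2]/=.
have od1 : odd d.+1 by move: od => /=; rewrite negbK.
have [inv _ /(_ od) si] := all_inv d.+3; have [inv1 _ /(_ od1) si1] := all_inv d.+1.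
have [inv2 _ _] := all_inv d.+2.
have ur : (uphalf d.+3 <= top_idx d.+2)%N by rewrite /top_idx; lia.
have dm2 : (d.+2 < m)%N by lia.
have uk : uphalf d.+3 = top_idx d.+1 by rewrite /top_idx; lia.
have wB : wf d.+4 m.+1 (ballF d.+3 (uphalf d.+3) m.+1).
  by apply: (bi_wf inv) => //; rewrite /top_idx.
have wbB := wf_bd wB.
rewrite sphereF_succ // (in_generated_cones _ _ wbB (wf_opp wbB)).
have gF c n S x (Y : face) : wf c n S -> (n < `|x|)%N -> x \in Y ->
    (Y \in generated S) = false.
  move=> wS nx xY; apply/negP => /(generated_avoids (wf_avoids wS nx)).
  by rewrite xY.
have wT := wfS (fsubsetDl _ (ballF d.+3 (uphalf d.+3) m.+1 `|`
  opp_complex (ballF d.+3 (uphalf d.+3) m.+1))) (si_wf si dm).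
rewrite (gF _ _ _ m.+2%:Z X wT) //=.
rewrite (gF _ _ _ m.+2%:Z (X `\ - m.+2%:Z) (wf_opp wbB)) ?orbF //; last first.
  by rewrite in_fsetD1 X2 andbT; lia.
have wP : wf d.+3 m (ballF d.+2 (uphalf d.+3) m) by apply: (bi_wf inv2).
have wQ : wf d.+3 m (opp_complex (ballF d.+2 (uphalf d.+3).-1 m)).
  by apply/wf_opp/(bi_wf inv2) => //; lia.
have sQ : opp_complex (ballF d.+2 (uphalf d.+3).-1 m) `<=` ballF d.+2 (uphalf d.+3) m.
  by apply: (bi_opp inv2) => //; lia.
rewrite [ballF d.+3 _ _]ballF_low // (bd_cones wP wQ sQ).
rewrite (in_generated_cones _ _ (wf_bd wP) (wf_bd wQ)).
have X1' : m.+1%:Z \in X `\ m.+2%:Z by rewrite in_fsetD1 X1 andbT; lia.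
rewrite (gF _ _ _ m.+1%:Z (X `\ m.+2%:Z) (wfS (fsubsetDl _ _) wP)) //=.
rewrite (gF _ _ _ m.+1%:Z (X `\ m.+2%:Z `\ - m.+1%:Z) (wf_bd wQ)) ?orbF //; last first.
  by rewrite in_fsetD1 X1' andbT; lia.
by rewrite -(bd_ballF_top od1 inv1 si1 dm2) -uk.
Qed.

(** * Missing faces *)

Lemma notin_V (X : face) n x : X `<=` V n -> (n < `|x|)%N -> x \notin X.
Proof. by move=> XV nx; apply/negP => /(fsubsetP XV); rewrite inV; lia. Qed.

Lemma V_D1_id (X : face) n x : X `<=` V n -> (n < `|x|)%N -> X `\ x = X.
Proof. by move=> XV nx; apply/mem_fsetD1/(notin_V XV). Qed.

Lemma face_low d j n X : (j <= top_idx d)%N -> (d < n)%N ->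
  (X \in generated (ballF d.+1 j n.+1)) =
  (X `\ n.+1%:Z \in generated (ballF d j n)) ||
  (opp_face (X `\ - n.+1%:Z) \in generated (ballF d j.-1 n)).
Proof.
move=> jr dn; have [inv _ _] := all_inv d.
have wP : wf d.+1 n (ballF d j n) by apply: (bi_wf inv).
have wQ : wf d.+1 n (opp_complex (ballF d j.-1 n)).
  by apply/wf_opp/(bi_wf inv) => //; lia.
by rewrite ballF_low // (in_generated_cones _ _ wP wQ) generated0 in_generated_opp.
Qed.

Lemma generated_ballF_V d j n X : (j <= top_idx d)%N -> (d < n)%N ->
  X \in generated (ballF d j n) -> X `<=` V n.
Proof.
move=> jr dn XS; have [inv _ _] := all_inv d.
by have [] := generated_wf (bi_wf inv jr dn) XS.
Qed.

Lemma face_low_neg d j n X : (j <= top_idx d)%N -> (d < n)%N -> - n.+1%:Z \in X ->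
  X \in generated (ballF d.+1 j n.+1) ->
  opp_face (X `\ - n.+1%:Z) \in generated (ballF d j.-1 n).
Proof.
move=> jr dn nX; rewrite face_low // => /orP[h|//].
have /notin_V := generated_ballF_V jr dn h.
move=> /(_ (- n.+1%:Z)); rewrite in_fsetD1 nX andbT; lia.
Qed.

Lemma face_low_none d j n X : (j <= top_idx d)%N -> (d < n)%N -> X `<=` V n ->
  X \in generated (ballF d.+1 j n.+1) ->
  X \in generated (ballF d j n) \/ opp_face X \in generated (ballF d j.-1 n).
Proof.
move=> jr dn XV; rewrite face_low // !(V_D1_id XV); [|lia|lia].
by case/orP; [left|right].
Qed.

(** A replacement creates no face on old vertices: the bases of the new cones are boundaries of
    balls inside the old sphere. *)
Lemma sphereF_anti d m n X : odd d -> (d < m)%N -> (m <= n)%N -> X `<=` V m ->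
  X \in generated (sphereF d n) -> X \in generated (sphereF d m).
Proof.
move=> od dm + XV; have [inv _ /(_ od) si] := all_inv d.
elim: n => [|n IHn] mn; first by lia.
have [<-//|mn'] := eqVneq m n.+1; have {}mn : (m <= n)%N by lia.
have dn : (d < n)%N by lia.
have wB : wf d.+1 n (ballF d (uphalf d) n) by apply: (bi_wf inv) => //; rewrite /top_idx.
have wbB := wf_bd wB.
have BT := generatedS (si_sub si dn).
rewrite sphereF_succ // (in_generated_cones _ _ wbB (wf_opp wbB)).
rewrite !(V_D1_id XV); [|lia|lia]; case/or3P => XS; apply: IHn => //.
- by apply: (fsubsetP (generatedS _) _ XS); apply: fsubsetDl.
- by apply: (fsubsetP BT); apply: generated_bd.
- rewrite -(si_opp si) // generated_opp in_opp_complex.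
  apply: (fsubsetP BT); apply: generated_bd.
  by rewrite -in_generated_opp.
Qed.

Lemma sphereF_face_top d n X x : odd d -> (d < n)%N -> (`|x| = n.+1)%N -> x \in X ->
  X \in generated (sphereF d n.+1) ->
  (X `\ x \in generated (bd (ballF d (uphalf d) n))) ||
  (opp_face (X `\ x) \in generated (bd (ballF d (uphalf d) n))).
Proof.
move=> od dn xn xX; have [inv _ /(_ od) si] := all_inv d.
have wB : wf d.+1 n (ballF d (uphalf d) n) by apply: (bi_wf inv) => //; rewrite /top_idx.
have wbB := wf_bd wB.
rewrite sphereF_succ // (in_generated_cones _ _ wbB (wf_opp wbB)) in_generated_opp.
have N (Y : face) : Y `<=` V n -> x \in Y -> False.
  by move=> /notin_V h xY; have := h x; rewrite xY xn; lia.
case/or3P => XS.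
- exfalso; apply: (N X) => //.
  by have [] := generated_wf (wfS (fsubsetDl _ _) (si_wf si dn)) XS.
- have [XV _] := generated_wf wbB XS; have [->|xe] := eqVneq x n.+1%:Z; first by rewrite XS.
  by exfalso; apply: (N _ XV); rewrite in_fsetD1 xX andbT.
- have [XV _] := generated_wf wbB XS.
  have [->|xe] := eqVneq x (- n.+1%:Z); first by rewrite XS orbT.
  exfalso; apply: (N (X `\ - n.+1%:Z)); last by rewrite in_fsetD1 xX andbT.
  by rewrite -opp_faceS opp_V.
Qed.

Lemma sphereF_face_pos d n X : odd d -> (d < n)%N -> n.+1%:Z \in X ->
  X \in generated (sphereF d n.+1) ->
  X `\ n.+1%:Z \in generated (bd (ballF d (uphalf d) n)).
Proof.
move=> od dn nX; have [inv _ /(_ od) si] := all_inv d.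
have wB : wf d.+1 n (ballF d (uphalf d) n) by apply: (bi_wf inv) => //; rewrite /top_idx.
have wbB := wf_bd wB.
rewrite sphereF_succ // (in_generated_cones _ _ wbB (wf_opp wbB)) in_generated_opp.
have N (Y : face) : Y `<=` V n -> n.+1%:Z \in Y -> False.
  by move=> /notin_V h xY; have := h n.+1%:Z; rewrite xY; lia.
case/or3P => // XS; exfalso.
- apply: (N X) => //.
  by have [] := generated_wf (wfS (fsubsetDl _ _) (si_wf si dn)) XS.
- have [XV _] := generated_wf wbB XS.
  apply: (N (X `\ - n.+1%:Z)); last by rewrite in_fsetD1 nX andbT; lia.
  by rewrite -opp_faceS opp_V.
Qed.

(* [nonface k m S] : from m vertices on, [S] is missing from all the spheres of
   dimension at most 2k - 1. The last two conditions exclude the faces of the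
   vertex B^{0,0} and of its antipode, at which the recursion can also end. *)
Definition nonface (k m : nat) (S : face) : Prop :=
  [/\ forall j n, (0 < j <= k)%N -> (m <= n)%N -> (2 * j <= n)%N ->
        S \notin generated (sphereF (2 * j - 1) n),
      ~~ (S `<=` [fset 1]) & ~~ (S `<=` [fset -1])].

Lemma nonface_opp k m S : nonface k m S -> nonface k m (opp_face S).
Proof.
move=> [h h1 h2]; split.
- move=> j n jk mn jn; have od : odd (2 * j - 1) by lia.
  have [_ _ /(_ od) si] := all_inv (2 * j - 1).
  rewrite -in_generated_opp si_opp; first exact: h.
    exact: si.
  lia.
- by rewrite -[[fset 1]]opp_faceK opp_faceS opp_face1.
- by rewrite -[[fset -1]]opp_faceK opp_faceS opp_face1 opprK.
Qed.

Lemma nonfaceW k k' m m' S : (k' <= k)%N -> (m <= m')%N ->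
  nonface k m S -> nonface k' m' S.
Proof. by move=> kk mm [h h1 h2]; split=> // j n jk mn jn; apply: h; lia. Qed.

(* The recursion for B^{d,i}_n only removes vertices above [S] until it ends in
   a sphere of dimension 2i' - 1 with i' <= i, or in B^{0,0}. *)
Lemma nonface_ball d j n m S : (j <= top_idx d)%N -> (m + d <= n)%N -> (d < n)%N ->
  S `<=` V m -> nonface j.-1 m S -> S \notin generated (ballF d j n).
Proof.
elim: d j n S => [|d IHd] j n S jr mdn dn SV nS.
  apply/negP; case: j jr nS => [|[|j]] // _ [_ _ h2]; first by rewrite ballF0 generated0.
  by move=> /in_generated[F]; rewrite inE => /eqP ->; apply/negP.
case: n dn mdn => // n dn mdn.
have [jd|jd] := leqP j (top_idx d).
  apply/negP => /face_low_none; case=> //.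
  - by apply: subV SV; lia.
  - by apply/negP/IHd => //; lia.
  - apply/negP/IHd; try lia; first by rewrite -opp_faceS opp_faceK opp_V.
    by apply/nonface_opp/(nonfaceW _ _ nS); lia.
have od : ~~ odd d by move: jr jd; rewrite /top_idx; lia.
have -> : j = (top_idx d).+1 by move: jr jd; rewrite /top_idx; lia.
rewrite ballF_top //; have [h _ _] := nS.
apply: contraNN (h (top_idx d) n.+1 _ _ _); [|by rewrite /top_idx in jd *; lia..].
have -> : (2 * top_idx d - 1 = d.+1)%N by rewrite /top_idx; lia.
by move=> h'; apply: (fsubsetP (generatedS _) _ h'); apply: fsubsetDl.
Qed.

(** By [sphereF_anti] it suffices to look at the moment when [x] is a top vertex; then [S] would
    lie, up to sign, in B^{2j-1,j-1}. Unfolding this ball drops one vertex in each of at most 2j - 1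
    levels, and the gap of [2 * k.+1] keeps all of them above [S], so that [nonface_ball]
    applies. *)
Lemma nonface_add k m S x : S `<=` V m -> (m + 2 * k.+1 <= `|x|)%N ->
  nonface k m S -> nonface k.+1 `|x|%N (x |` S).
Proof.
move=> SV mx nS.
have m0 : (0 < m)%N.
  rewrite lt0n; have [_ /fsubsetPn[y yS _] _] := nS.
  by apply: contraTneq (fsubsetP SV _ yS) => ->; rewrite inV; lia.
split.
- move=> j n jk mn jn; apply/negP => XS.
  have od : odd (2 * j - 1) by lia.
  have [inv _ /(_ od) si] := all_inv (2 * j - 1).
  have {XS} : x |` S \in generated (sphereF (2 * j - 1) `|x|%N).
    apply: sphereF_anti XS => //; first lia.
    rewrite fsubUset fsub1set inV (subV _ SV) ?andbT; lia.
  have x0 : (0 < `|x|)%N by lia.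
  rewrite -(prednK x0) => XS; have dn : (2 * j - 1 < `|x|.-1)%N by lia.
  have xS : x \notin S by apply: notin_V SV _; lia.
  have uj : uphalf (2 * j - 1) = j by lia.
  have := sphereF_face_top od dn (esym (prednK x0)) (fset1U1 x S) XS.
  rewrite fsetU1K // uj => h.
  have {h} : S \in generated (ballF (2 * j - 1) j `|x|.-1) \/
            opp_face S \in generated (ballF (2 * j - 1) j `|x|.-1).
    by case/orP: h => /generated_bd; [left|right].
  have nj := nonfaceW (_ : j.-1 <= k)%N (leqnn m) nS.
  case; apply/negP/(nonface_ball (m := m)); rewrite /top_idx; try lia => //.
  + by apply: nj; lia.
  + by rewrite -opp_faceS opp_faceK opp_V.
  + by apply/nonface_opp/nj; lia.
- by rewrite fsubUset fsub1set inE negb_and; apply/orP; left; lia.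
- by rewrite fsubUset fsub1set inE negb_and; apply/orP; left; lia.
Qed.

Lemma nonface_above K k t m S : (k + t <= K)%N -> S `<=` V m -> antipode_free S ->
  nonface k m S ->
  exists S', [/\ S `<=` S', S' `<=` V (m + 2 * K * t), antipode_free S',
    #|` S'| = (#|` S| + t)%N & nonface (k + t) (m + 2 * K * t) S'].
Proof.
move=> + SV Sf nS; elim: t => [|t IHt] ktK.
  by exists S; rewrite muln0 !addn0.
have [|S' [SS SV' Sf' Sc nS']] := IHt; first by lia.
set m' := (m + 2 * K * t)%N in SV' nS'.
have -> : (m + 2 * K * t.+1 = m' + 2 * K)%N by rewrite /m'; lia.
(* The gap 2K meets the demand of [nonface_add] in every round, because the index never exceeds
   K. *)
set x : int := (m' + 2 * K)%N%:Z.
have xS : x \notin S' by apply: (notin_V SV'); rewrite /x; lia.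
exists (x |` S'); split.
- exact: fsubset_trans SS (fsubsetU1 _ _).
- rewrite fsubUset fsub1set inV (subV _ SV') ?andbT; rewrite /x; lia.
- apply/antipode_freeP => y; rewrite !in_fset1U negb_or => /orP[/eqP ->|yS].
    by rewrite (notin_V SV') ?andbT; rewrite /x; lia.
  rewrite andbC (antipode_freeP _ Sf' _ yS) /=.
  have := fsubsetP SV' _ yS; rewrite inV /x; lia.
- by rewrite cardfsU1 xS Sc; lia.
- rewrite addnS; apply: (nonface_add (x := x) SV' _ nS'); rewrite /x; lia.
Qed.

Lemma in_ballF_pos d j n F : (j <= top_idx d)%N -> n.+1%:Z \in F ->
  F `\ n.+1%:Z \in ballF d j n -> F \in ballF d.+1 j n.+1.
Proof. by move=> jr nF FP; rewrite ballF_low // in_cones nF FP orbT. Qed.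

Lemma in_ballF_neg d j n F : (j <= top_idx d)%N -> n.+1%:Z \in F ->
  F `\ n.+1%:Z \in ballF d j.-1 n -> opp_face F \in ballF d.+1 j n.+1.
Proof.
move=> jr nF FP; rewrite ballF_low // in_cones in_opp_complex !in_opp_face opprK nF.
by rewrite opp_faceD opp_face1 opprK opp_faceK FP !orbT.
Qed.

Lemma face_bd_low_pos d j n X : (j <= top_idx d)%N -> (d < n)%N -> n.+1%:Z \in X ->
  X \in generated (bd (ballF d.+1 j n.+1)) ->
  X `\ n.+1%:Z \in generated (bd (ballF d j n)).
Proof.
move=> jr dn nX; have [inv _ _] := all_inv d.
have wP : wf d.+1 n (ballF d j n) by apply: (bi_wf inv).
have wQ : wf d.+1 n (opp_complex (ballF d j.-1 n)).
  by apply/wf_opp/(bi_wf inv) => //; lia.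
have sQ : opp_complex (ballF d j.-1 n) `<=` ballF d j n.
  case: j jr {wP wQ} => [|j] jr; first by rewrite ballF0 opp_complex0 fsub0set.
  by apply: (bi_opp inv).
rewrite ballF_low // (bd_cones wP wQ sQ) (in_generated_cones _ _ (wf_bd wP) (wf_bd wQ)).
have N (Y : face) : Y `<=` V n -> n.+1%:Z \in Y -> False.
  by move=> /notin_V h xY; have := h n.+1%:Z; rewrite xY; lia.
case/or3P => // XS; exfalso.
- by apply: (N X) => //; have [] := generated_wf (wfS (fsubsetDl _ _) wP) XS.
- have [XV _] := generated_wf (wf_bd wQ) XS.
  by apply: (N _ XV); rewrite in_fsetD1 nX andbT; lia.
Qed.

Lemma face_bd_low_neg d j n X : (j <= top_idx d)%N -> (d < n)%N -> - n.+1%:Z \in X ->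
  X \in generated (bd (ballF d.+1 j n.+1)) ->
  opp_face (X `\ - n.+1%:Z) \in generated (bd (ballF d j.-1 n)).
Proof.
move=> jr dn nX; have [inv _ _] := all_inv d.
have wP : wf d.+1 n (ballF d j n) by apply: (bi_wf inv).
have wQ : wf d.+1 n (opp_complex (ballF d j.-1 n)).
  by apply/wf_opp/(bi_wf inv) => //; lia.
have sQ : opp_complex (ballF d j.-1 n) `<=` ballF d j n.
  case: j jr {wP wQ} => [|j] jr; first by rewrite ballF0 opp_complex0 fsub0set.
  by apply: (bi_opp inv).
rewrite ballF_low // (bd_cones wP wQ sQ) (in_generated_cones _ _ (wf_bd wP) (wf_bd wQ)).
have N (Y : face) : Y `<=` V n -> - n.+1%:Z \in Y -> False.
  by move=> /notin_V h xY; have := h (- n.+1%:Z); rewrite xY; lia.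
rewrite [in X in X -> _]bd_opp in_generated_opp.
case/or3P => // XS; exfalso.
- by apply: (N X) => //; have [] := generated_wf (wfS (fsubsetDl _ _) wP) XS.
- have [XV _] := generated_wf (wf_bd wP) XS.
  by apply: (N _ XV); rewrite in_fsetD1 nX andbT; lia.
Qed.

(* A facet through {b - 1, b} with all its other vertices below is created
   with the vertex b, and it lies in one of the two balls removed in the next
   step; so this edge survives only through the boundaries of these balls. *)
Lemma sphereF_consecutive d m n (T : face) : odd d -> (2 < d)%N -> (d < m.+2)%N ->
  (m.+2 < n)%N -> T `<=` V m ->
  m.+2%:Z |` (m.+1%:Z |` T) \in generated (sphereF d n) ->
  T \in generated (ballF d.-2 (uphalf d).-1 m).
Proof.
case: d => [|[|[|d]]] // od _ dm mn TV; set X := _ |` _ => XS.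
rewrite [d.+3.-2]/=.
have d3m : (d.+3 < m.+3)%N by lia.
have dm1 : (d.+1 < m)%N by lia.
have dm2 : (d.+2 < m.+1)%N by lia.
have m12 : (m.+1%:Z == m.+2%:Z) = false by lia.
have [m2 m3 om3] : [/\ (m < `|m.+2|)%N, (m.+2 < `|m.+3|)%N &
    (m.+2 < `|- m.+3%:Z|)%N] by split; lia.
have m2X : m.+2%:Z \in X by rewrite fset1U1.
have m1X : m.+1%:Z \in X by rewrite !inE eqxx orbT.
have T2 : m.+2%:Z \notin T by apply: notin_V TV _.
have T1 : m.+1%:Z \notin T by apply: notin_V TV _.
have XE : X `\ m.+2%:Z = m.+1%:Z |` T.
  by rewrite fsetU1K // !inE negb_or T2 eq_sym m12.
have XV : X `<=` V m.+2.
  by rewrite !fsubUset !fsub1set !inV (subV _ TV) ?andbT; lia.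
have od1 : odd d.+1 by move: od => /=; rewrite negbK.
have [inv _ /(_ od) si] := all_inv d.+3; have [inv1 _ /(_ od1) si1] := all_inv d.+1.
have ur : (uphalf d.+3 <= top_idx d.+2)%N by clear; rewrite /top_idx; lia.
have ur1 : ((uphalf d.+3) <= top_idx d.+1)%N by clear; rewrite /top_idx; lia.
have ur2 : ((uphalf d.+3).-1 <= top_idx d.+1)%N by clear; rewrite /top_idx; lia.
have uk : uphalf d.+3 = (top_idx d).+1 by clear -od; rewrite /top_idx; lia.
have uk' : (uphalf d.+3).-1 = uphalf d.+1 by clear; lia.
have urg : uphalf d.+1 = top_idx d by clear -od; rewrite /top_idx; lia.
have wB : wf d.+4 m.+2 (ballF d.+3 (uphalf d.+3) m.+2).
  by apply: (bi_wf inv) => //; rewrite /top_idx.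
have wbB := wf_bd wB.
have topE : ballF d.+1 (uphalf d.+3) m = sphereF d.+1 m `\` ballF d.+1 (uphalf d.+1) m.
  by rewrite uk urg ballF_top //; move: od1.
have {XS} : X \in generated (sphereF d.+3 m.+3) by apply: sphereF_anti XS => //; apply: subV XV.
rewrite sphereF_succ // (in_generated_cones _ _ wbB (wf_opp wbB)) in_generated_opp.
rewrite !(V_D1_id XV) //; case/or3P.
- move=> /in_generated[F]; rewrite in_fsetD in_fsetU in_opp_complex negb_or.
  move=> /andP[/andP[FB FB'] FT] XF; exfalso.
  have F2 := fsubsetP XF _ m2X; have F1 := fsubsetP XF _ m1X.
  have F1' : m.+1%:Z \in F `\ m.+2%:Z by rewrite in_fsetD1 F1 m12.
  have [FV Ff Fc] := si_wf si dm FT.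
  have Fc' : #|` F `\ m.+2%:Z `\ m.+1%:Z| = d.+2.
    have := cardfsD1 m.+2%:Z F; have := cardfsD1 m.+1%:Z (F `\ m.+2%:Z).
    by clear -F1' F2 Fc; rewrite F1' F2 Fc; lia.
  have F'T : F `\ m.+2%:Z `\ m.+1%:Z \in sphereF d.+1 m.
    have [dm'|md] := ltnP d.+3 m.+1.
      rewrite -(mem_generated (wf_pure (si_wf si1 dm1)) Fc') -(@sphereF_top2 d.+3) //.
      by apply/in_generated; exists F.
    have mE : m = d.+2 by clear -md dm; lia.
    have -> : sphereF d.+1 m = cross m by rewrite sphereF_min mE.
    rewrite in_cross Fc' -mE eqxx andbT.
    have Ff' := antipode_freeS (fsubsetDl F [fset m.+2%:Z]) Ff.
    rewrite (antipode_freeS (fsubsetDl _ _) Ff') andbT.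
    by apply: antipode_freeD1_V => //; apply: antipode_freeD1_V.
  have [FBl|FBl] := boolP (F `\ m.+2%:Z `\ m.+1%:Z \in ballF d.+1 (uphalf d.+1) m).
    by case/negP: FB'; apply: in_ballF_neg => //; apply: in_ballF_pos => //; rewrite uk'.
  by case/negP: FB; apply: in_ballF_pos => //; apply: in_ballF_pos => //; rewrite topE in_fsetD FBl.
- move=> /(face_bd_low_pos ur dm2 m2X); rewrite XE.
  move=> /(face_bd_low_pos ur1 dm1 (fset1U1 _ _)); rewrite fsetU1K // topE.
  by rewrite bd_sphD // uk' => /generated_bd.
- have oX : - m.+2%:Z \in opp_face X by rewrite in_opp_face opprK.
  move=> /(face_bd_low_neg ur dm2 oX).
  rewrite -[[fset - _]]opp_face1 -opp_faceD opp_faceK XE.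
  move=> /(face_bd_low_pos ur2 dm1 (fset1U1 _ _)); rewrite fsetU1K //.
  by move=> /generated_bd.
Qed.

Lemma nonface_single m x : (1 < `|x|)%N -> nonface 0 m [fset x].
Proof.
by move=> x1; split; [move=> j n; lia|..]; rewrite fsub1set inE; lia.
Qed.

Lemma nonface_small k m S : (2 < #|` S|)%N ->
  (forall j n, (1 < j <= k)%N -> (m <= n)%N -> (2 * j <= n)%N ->
     S \notin generated (sphereF (2 * j - 1) n)) -> nonface k m S.
Proof.
move=> S2 h; have sub (X : face) : S `<=` X -> (2 < #|` X|)%N.
  by move=> /fsubset_leq_card; apply: leq_trans.
split; try by apply/negP => /sub; rewrite cardfs1.
move=> j n jk mn jn; have [j1|j1] := ltnP 1 j; first by apply: h => //; lia.
have -> : j = 1%N by lia.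
apply/negP => /in_generated[F FT /sub].
have [_ _ si] := all_inv 1; have n1 : (1 < n)%N by lia.
by have [_ _ ->] := si_wf (si isT) n1 FT.
Qed.

(** With at least [|b|.+1] vertex pairs [b] is not the last positive vertex, so its neighbours in
    the cycle are b - 1 and b + 1 and never -1. *)
Lemma nonface_pair (a b : int) : (0 < `|a|)%N -> `|a|%:Z < b -> a != b - 1 ->
  nonface 1 `|b|.+1 [fset a; b].
Proof.
move=> a0 ab aNb; have c2 : #|` [fset a; b]| = 2%N by rewrite cardfs2; lia.
have sub x : ~~ ([fset a; b] `<=` [fset x]).
  by apply/negP => /fsubset_leq_card; rewrite c2 cardfs1.
split=> // j n jk mn jn; have -> : (2 * j - 1 = 1)%N by lia.
have n1 : (1 < n)%N by lia.
have [_ _ /(_ isT) si] := all_inv 1.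
rewrite (mem_generated (wf_pure (si_wf si n1)) c2); apply/negP => /sphereF1P-/(_ n1)[x].
rewrite inV => xV /fsetP e; have := e a; have := e b.
by rewrite !inE !eqxx ?orbT; cycle_lia.
Qed.

(** By [sphereF_consecutive] the vertex 1 would belong to the edge B^{1,0} = {-1, b-2}, but b - 2 >
    1. *)
Lemma nonface_triple (b : nat) : (3 < b)%N ->
  nonface 2 b.+1 (b%:Z |` (b.-1%:Z |` [fset 1])).
Proof.
case: b => [|[|m]] // b3; rewrite [m.+2.-1]/=.
apply: nonface_small => [|j n jk mn jn].
  by rewrite !cardfsU1 cardfs1 !inE; lia.
have -> : (2 * j - 1 = 3)%N by lia.
have m1 : (1 < m)%N by lia.
apply/negP => /sphereF_consecutive; move=> /(_ isT isT _ _ _)/=.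
rewrite fsub1set inV => h.
have /in_generated[F] : [fset 1] \in generated (ballF 1 1 m) by apply: h; lia.
by rewrite ballF1E // => /eqP ->; rewrite fsub1set !inE; lia.
Qed.

(** Serves the edge {2, 3}, which lies too low for [nonface_triple]. The facets of Delta^3_4 over
    this triangle add 4 or -4, and both lie in the antipode of B^{3,1}_4. They are removed when 5
    enters, and the triangle is on neither of the two boundaries. *)
Lemma nonface_m1_2_3 : nonface 2 5 [fset -1; 2; 3].
Proof.
set X : face := [fset _; _; _].
have Xc : #|` X| = 3%N by rewrite /X fsetUC cardfsU1 cardfs2 !inE.
apply: nonface_small => [|j n jk mn jn]; first by rewrite Xc.
have -> : (2 * j - 1 = 3)%N by lia.
have XV3 : X `<=` V 3 by rewrite /X fsubUset sub2E fsub1set !inV.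
have XV : X `<=` V 4 by apply: subV XV3.
apply/negP => /(sphereF_anti (m := 5)) XS.
have {XS} : X \in generated (sphereF 3 5) by apply: XS => //; apply: subV XV.
have [inv3 _ /(_ isT) si] := all_inv 3; have [inv2 _ _] := all_inv 2.
have wB : wf 4 4 (ballF 3 2 4) by apply: (bi_wf inv3).
have wbB := wf_bd wB.
have wP : wf 3 3 (ballF 2 2 3) by apply: (bi_wf inv2).
have wQ : wf 3 3 (opp_complex (ballF 2 1 3)) by apply/wf_opp/(bi_wf inv2).
have sQ : opp_complex (ballF 2 1 3) `<=` ballF 2 2 3 by apply: (bi_opp inv2).
have X3 : 3 \in X by rewrite !inE.
have XD3 : X `\ 3 = [fset 2; -1] by rewrite /X fsetUC fsetU1K ?inE // fsetUC.
have p1 : [fset 2; -1] \in ballF 1 1 2 by rewrite ballF1E.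
have p2 : X \in ballF 2 1 3 by apply: in_ballF_pos => //; rewrite XD3.
have p3 : opp_face X \in ballF 2 2 3 by apply: in_ballF_neg => //; rewrite XD3.
rewrite sphereF_succ // (in_generated_cones _ _ wbB (wf_opp wbB)) in_generated_opp.
have bE (Y : face) : Y `<=` V 3 -> #|` Y| = 3%N ->
    (Y \in generated (bd (ballF 3 2 4))) = (Y \in ballF 2 2 3 `\` opp_complex (ballF 2 1 3)).
  move=> YV Yc; rewrite (mem_generated (wf_pure wbB) Yc) ballF_low //.
  rewrite (bd_cones wP wQ sQ) in_cones.
  by rewrite !(negbTE (notin_V YV _)) // orbF.
rewrite !(V_D1_id XV) //; case/or3P.
- move=> /in_generated[F]; rewrite in_fsetD in_fsetU in_opp_complex negb_or.
  move=> /andP[/andP[_ FB'] FT] XF; case/negP: FB'.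
  have [/fsubsetP FV /antipode_freeP Ff Fc] := si_wf si (isT : 3 < 4)%N FT.
  have /cardfs1P[x xE] : #|` F `\` X| == 1%N by rewrite cardfsDS // Fc Xc.
  have FE : F = x |` X.
    by rewrite -xE fsetUDr fsetDv fsetD0; apply/esym/fsetUidPl.
  have [xX xF] : x \notin X /\ x \in F.
    by have := fset11 x; rewrite -xE in_fsetD => /andP.
  have oX y : y \in X -> x != - y.
    by move=> /(fsubsetP XF)/Ff; apply: contraNneq => <-.
  have x4 : (x == 4) || (x == -4).
    have := FV _ xF; rewrite inV; move: xX (oX (-1)) (oX 2) (oX 3).
    by clear; rewrite !inE /=; lia.
  have U (Y : face) : Y `<=` V 3 -> (3.+1%:Z |` Y) `\ 3.+1%:Z = Y.
    by move=> YV; rewrite fsetU1K // (notin_V YV).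
  have oXV : opp_face X `<=` V 3 by rewrite -opp_faceS opp_faceK opp_V.
  case/orP: x4 => /eqP xe; rewrite {}xe in FE; rewrite FE.
    by apply: (@in_ballF_neg 2 2 3 _ isT (fset1U1 _ _)); rewrite U; [exact: p2 | exact: XV3].
  rewrite opp_faceU opp_face1.
  by apply: (@in_ballF_pos 2 2 3 _ isT (fset1U1 _ _)); rewrite U; [exact: p3 | exact: oXV].
- rewrite bE // in_fsetD => /andP[_]; rewrite (@ballF_low 1) // in_cones in_fset0.
  case/or3P=> // /andP[h]; last by rewrite !inE in h.
  have top : ballF 1 2 2 = sphereF 1 2 `\` ballF 1 1 2 := @ballF_top 0 2 isT.
  by rewrite XD3 [ballF _ _ _]top in_fsetD p1.
- rewrite bE ?card_opp_face ?Xc //; last by rewrite -opp_faceS opp_faceK opp_V.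
  by rewrite in_fsetD in_opp_complex opp_faceK p2.
Qed.

Definition signed_set (m c : nat) (S : face) : Prop :=
  [/\ S `<=` V m, antipode_free S & #|` S| = c].

Lemma signed_set0 m : signed_set m 0 fset0.
Proof. by split; rewrite ?fsub0set ?cardfs0 //; apply/antipode_freeP. Qed.

Lemma signed_setW m m' c S : (m <= m')%N -> signed_set m c S -> signed_set m' c S.
Proof. by move=> mm [SV Sf Sc]; split=> //; apply: subV SV. Qed.

Lemma signed_setU1 m c S x : (m < `|x|)%N -> signed_set m c S ->
  signed_set `|x|%N c.+1 (x |` S).
Proof.
move=> mx [SV Sf Sc]; have xS := notin_V SV mx; split.
- by rewrite fsubUset fsub1set inV (subV _ SV) ?andbT; lia.
- apply/antipode_freeP => y; rewrite !in_fset1U negb_or => /orP[/eqP ->|yS].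
    rewrite (notin_V SV) ?abszN // andbT; lia.
  rewrite (antipode_freeP _ Sf _ yS) andbT.
  have := fsubsetP SV _ yS; rewrite inV; lia.
- by rewrite cardfsU1 xS Sc.
Qed.

Lemma signed_set_pair (a b : int) : (0 < `|a|)%N -> (`|a| < `|b|)%N ->
  signed_set `|b|%N 2 [fset a; b].
Proof.
move=> a0 ab; rewrite fsetUC -[[fset a]]fsetU0.
apply: signed_setU1 ab _; apply: (signed_setU1 (m := 0)) => //.
exact: signed_set0.
Qed.

Lemma nonface_extend K k t m c S : (k + t <= K)%N -> signed_set m c S ->
  nonface k m S ->
  exists S', [/\ S `<=` S', signed_set (m + 2 * K * t) (c + t) S'
    & nonface (k + t) (m + 2 * K * t) S'].
Proof.
move=> kt [SV Sf Sc] nS; have [S' [SS SV' Sf' Sc' nS']] := nonface_above kt SV Sf nS.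
by exists S'; split=> //; split; rewrite // Sc' Sc.
Qed.

Lemma nonface_spread K t : (t <= K)%N ->
  exists G, signed_set (2 + 2 * K * t) t.+1 G /\ nonface t (2 + 2 * K * t) G.
Proof.
move=> tK; have s2 : signed_set 2 1 [fset 2].
  by rewrite -[[fset 2]]fsetU0; apply: (signed_setU1 (m := 0)) => //; apply: signed_set0.
have := @nonface_single 2 2 isT => /(nonface_extend (K := K) (t := t) _ s2).
by rewrite add0n => /(_ tK) [G [_ sG nG]]; exists G.
Qed.

Lemma uphalf_odd k : (0 < k)%N -> uphalf (2 * k - 1) = k.
Proof. by lia. Qed.

(** Here [a] may be close to the top vertex, so [nonface_add] cannot supply the latter. Two levels
    of the ball recursion, dropping q+2 and q+1, lead to the sphere of dimension 2k - 3, from which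
    [a] together with [G] is missing. Any descent through a negative apex lowers the index and would
    place -G in a ball that cannot contain it. The values q+2 and q+1 of [a] would be consumed by a
    positive apex on the way. *)
Lemma nonface_top k m q (a : int) (G : face) : (1 < k)%N -> G `<=` V m ->
  nonface k.-2 m G -> (m + 2 * k <= `|a|)%N -> (`|a| < q.+3)%N ->
  a != q.+2%:Z -> a != q.+1%:Z -> (m + 2 * k <= q)%N ->
  q.+3%:Z |` (a |` G) \notin generated (sphereF (2 * k - 1) q.+3).
Proof.
move=> k1 GV nG ma aq a2 a1 mq; apply/negP.
case: k k1 nG ma mq => [|[|k]] // _ nG ma mq.
have -> : (2 * k.+2 - 1 = (2 * k).+3)%N by lia.
set d := (2 * k).+1; set Y := a |` G.
have od : odd d.+2 by rewrite /d /=; lia.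
have uk : uphalf d.+2 = k.+2 by rewrite /d; lia.
have aG : a \notin G by apply: notin_V GV _; lia.
have YV : Y `<=` V `|a|%N by rewrite fsubUset fsub1set inV (subV _ GV) ?andbT; lia.
have q3 : q.+3%:Z \notin Y by apply: notin_V YV _.
have nY : nonface k.+1 `|a|%N Y by apply: nonface_add GV _ nG; lia.
have noG d' n : (k.+1 <= top_idx d')%N -> (m + d' <= n)%N -> (d' < n)%N ->
    opp_face G \notin generated (ballF d' k.+1 n).
  move=> kr mn dn; apply: (nonface_ball (m := m)) => //.
    by rewrite -opp_faceS opp_faceK opp_V.
  exact: nonface_opp.
have noY d' n : (k.+1 <= top_idx d')%N -> (m + d' <= n)%N -> (d' < n)%N ->
    opp_face Y \notin generated (ballF d' k.+1 n).
  move=> kr mn dn; apply: contraNN (noG _ _ kr mn dn); apply: generated_sub.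
  by rewrite opp_faceS fsubsetUr.
have r1 : top_idx d = k.+2 by rewrite /top_idx /d; lia.
have r2 : top_idx d.+1 = k.+2 by rewrite /top_idx /d; lia.
have dq : (d.+2 < q.+2)%N by rewrite /d; lia.
have dq1 : (d.+1 < q.+1)%N by rewrite /d; lia.
have dq0 : (d < q)%N by rewrite /d; lia.
have mdq : (m + d <= q)%N by rewrite /d; lia.
have mdq1 : (m + d.+1 <= q.+1)%N by rewrite addnS.
have kq : (2 * k.+1 <= q)%N by lia.
have r1' : (k.+2 <= top_idx d)%N by rewrite r1.
have r2' : (k.+2 <= top_idx d.+1)%N by rewrite r2.
have aY : a \in Y by rewrite fset1U1.
move=> /(sphereF_face_pos od dq (fset1U1 _ _)); rewrite fsetU1K // uk => /generated_bd YB.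
have [ae|an2] := eqVneq a (- q.+2%:Z).
  have := face_low_neg r2' dq1 (_ : - q.+2%:Z \in Y) YB; rewrite -ae => /(_ aY).
  by rewrite fsetU1K //; apply/negP/(noG _ _ (ltnW r2') mdq1 dq1).
have aq1 : (`|a| <= q.+1)%N by clear -an2 a2 aq; lia.
have YV1 : Y `<=` V q.+1 by apply: subV YV.
have [{}YB|] := face_low_none r2' dq1 YV1 YB; last by apply/negP/(noY _ _ (ltnW r2') mdq1 dq1).
have [ae|an1] := eqVneq a (- q.+1%:Z).
  have := face_low_neg r1' dq0 (_ : - q.+1%:Z \in Y) YB; rewrite -ae => /(_ aY).
  by rewrite fsetU1K //; apply/negP/(noG _ _ (ltnW r1') mdq dq0).
have aq0 : (`|a| <= q)%N by clear -an1 a1 aq1; lia.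
have YV0 : Y `<=` V q by apply: subV YV.
have [{}YB|] := face_low_none r1' dq0 YV0 YB; last by apply/negP/(noY _ _ (ltnW r1') mdq dq0).
have topE : ballF d k.+2 q = sphereF d q `\` ballF d k.+1 q.
  have := @ballF_top (2 * k) q.
  rewrite (_ : top_idx (2 * k) = k.+1); last by clear; rewrite /top_idx; lia.
  by apply; clear; lia.
have [h _ _] := nY; have := h k.+1 q.
rewrite (_ : 2 * k.+1 - 1 = d)%N; last by clear; rewrite /d; lia.
have YT : Y \in generated (sphereF d q).
  by apply: (fsubsetP (generatedS _)) YB; rewrite topE fsubsetDl.
by rewrite YT leqnn aq0 kq => /(_ isT isT isT).
Qed.

(** The vertex -(q+2) is inserted so that its removal lowers the index and reverses signs; then q+1
    is removed at a negative apex and lowers the index again. This compensates for [G] having to be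
    missing only up to index k - 3. *)
Lemma nonface_top2 k m q (G : face) : (1 < k)%N -> G `<=` V m ->
  ((2 < k)%N -> nonface (k - 3) m G) -> (m + 2 * k <= q)%N ->
  q.+3%:Z |` (- q.+2%:Z |` (q.+1%:Z |` G)) \notin generated (sphereF (2 * k - 1) q.+3).
Proof.
move=> k1 GV nG mq; apply/negP.
case: k k1 nG mq => [|[|k]] // _ nG mq.
have -> : (2 * k.+2 - 1 = (2 * k).+3)%N by lia.
set d := (2 * k).+1.
have od : odd d.+2 by rewrite /d /=; lia.
have uk : uphalf d.+2 = k.+2 by rewrite /d; lia.
have r1 : top_idx d = k.+2 by rewrite /top_idx /d; lia.
have r2 : top_idx d.+1 = k.+2 by rewrite /top_idx /d; lia.
have q1 : q.+1%:Z \notin G by apply: notin_V GV _; lia.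
have Y1V : q.+1%:Z |` G `<=` V q.+1.
  by rewrite fsubUset fsub1set inV (subV _ GV) ?andbT; lia.
have q2 : - q.+2%:Z \notin q.+1%:Z |` G by apply: notin_V Y1V _; lia.
have Y2V : - q.+2%:Z |` (q.+1%:Z |` G) `<=` V q.+2.
  by rewrite fsubUset fsub1set inV (subV _ Y1V) ?andbT; lia.
have q3 : q.+3%:Z \notin - q.+2%:Z |` (q.+1%:Z |` G) by apply: notin_V Y2V _; lia.
have dq : (d.+2 < q.+2)%N by rewrite /d; lia.
move=> /(sphereF_face_pos od dq (fset1U1 _ _)); rewrite fsetU1K // uk => /generated_bd.
have dq1 : (d.+1 < q.+1)%N by rewrite /d; lia.
have dq0 : (d < q)%N by rewrite /d; lia.
have r1' : (k.+1 <= top_idx d)%N by rewrite r1.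
have r2' : (k.+2 <= top_idx d.+1)%N by rewrite r2.
move=> /(face_low_neg r2' dq1 (fset1U1 _ _)); rewrite fsetU1K //.
have oq : - q.+1%:Z \in opp_face (q.+1%:Z |` G) by rewrite in_opp_face opprK fset1U1.
move=> /(face_low_neg r1' dq0 oq).
rewrite -[[fset - _]]opp_face1 -opp_faceD opp_faceK fsetU1K //=.
(* If the original [k] is 2, the ball reached is B^{1,-1}, which is void. *)
case: (posnP k) => [->|k0]; first by rewrite ballF0 generated0.
apply/negP/(nonface_ball (m := m)) => //; first exact: ltnW.
  by rewrite /d; clear -mq; lia.
by have := nG k0; rewrite subSS subSS subn1.
Qed.

(** * Missing sets through a given edge *)

Definition witness (k n : nat) (e : face) : Prop :=
  exists S, [/\ e `<=` S, signed_set n k.+1 S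
    & S \notin generated (sphereF (2 * k - 1) n)].

(** The equation between [c] and [j] means c = j + 1, so k - j vertices above the set raise its size
    to k + 1 and the dimension to 2k - 1 simultaneously. *)
Lemma witness_above k n j c m (e S : face) : (1 < k)%N -> e `<=` S ->
  signed_set m c S -> nonface j m S -> (c + k = k.+1 + j)%N -> (j <= k)%N ->
  (m + 2 * k * k <= n)%N -> (2 * k <= n)%N -> witness k n e.
Proof.
move=> k1 eS sS nS cj jk mn kn.
have jkE : (j + (k - j) = k)%N by lia.
have [|S' [SS sS' nS']] := @nonface_extend k j (k - j) m c S _ sS nS; first by lia.
have le : (m + 2 * k * (k - j) <= n)%N.
  by apply: leq_trans mn; rewrite leq_add2l leq_mul2l leq_subr orbT.
exists S'; split; first exact: fsubset_trans SS.
  by apply: signed_setW le _; rewrite (_ : k.+1 = c + (k - j))%N //; lia.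
by have [h _ _] := nS'; apply: h; lia.
Qed.

Lemma witness_low k n (a b : int) : (1 < k)%N -> (0 < `|a|)%N -> `|a|%:Z < b ->
  (`|b| + 2 * k * k + 5 <= n)%N -> ~ (a = 1 /\ b = 2) -> (2 * k <= n)%N ->
  witness k n [fset a; b].
Proof.
move=> k1 a0 ab bn ne kn.
have [ae|aNb] := eqVneq a (b - 1); last first.
  apply: (witness_above (j := 1) (c := 2) (m := `|b|.+1) _ (fsubset_refl _)) => //; try lia.
    by apply: signed_setW (signed_set_pair a0 _); lia.
  exact: nonface_pair.
have sx (x m c : nat) S : (m < x)%N -> signed_set m c S ->
    signed_set x c.+1 (x%:Z |` S) by move=> mx; apply: (@signed_setU1 _ _ _ x%:Z).
have [b4|b4] := ltnP 3 `|b|%N.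
  apply: (witness_above (j := 2) (c := 3) (m := `|b|.+1) _ _ _ (nonface_triple b4)) => //; try lia.
  - have -> : (`|b|%N : int) = b by lia.
    have -> : (`|b|.-1%N : int) = a by lia.
    by rewrite sub2E !inE !eqxx !orbT.
  - apply: signed_setW (leqnSn _) _; apply: (sx _ `|b|.-1); first by lia.
    apply: (sx _ 1%N); first by lia.
    by rewrite -[[fset 1]]fsetU0; apply: (sx 1%N 0%N) => //; apply: signed_set0.
have be : b = 3 by case: (eqVneq b 2) => [b2|]; [case: ne | ]; lia.
have {}ae : a = 2 by lia.
apply: (witness_above (j := 2) (c := 3) (m := 5) _ _ _ nonface_m1_2_3) => //; try lia.
- by rewrite sub2E ae be !inE.
- apply: (signed_setW (m := 3)) => //; rewrite fsetUC; apply: (sx 3 2) => //.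
  by rewrite fsetUC; apply: (sx 2 1) => //; rewrite -[[fset _]]fsetU0;
    apply: (@signed_setU1 0 0 _ (-1)) => //; apply: signed_set0.
Qed.

(** The start is the non-consecutive pair of [a] and |a| + 2; k - 2 vertices follow in the gap, and
    [b] itself is the last vertex added by [nonface_add]. *)
Lemma witness_gap k n (a b : int) : (1 < k)%N -> (0 < `|a|)%N ->
  (`|a| + 2 * k * k + 2 * k + 3 <= `|b|)%N -> (`|b| <= n)%N -> (2 * k <= n)%N ->
  witness k n [fset a; b].
Proof.
move=> k1 a0 ab bn kn; pose c : int := (`|a| + 2)%N%:Z.
have nc : nonface 1 (`|a| + 3) [fset a; c].
  have <- : (`|c|.+1 = `|a| + 3)%N by rewrite /c; lia.
  by apply: nonface_pair => //; rewrite /c; lia.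
have sc : signed_set (`|a| + 3) 2 [fset a; c].
  by apply: (signed_setW (m := `|c|)); [|apply: signed_set_pair]; rewrite /c; lia.
have [|S' [SS sS nS]] := @nonface_extend k 1 (k - 2) _ _ _ _ sc nc; first by lia.
set m := (`|a| + 3 + 2 * k * (k - 2))%N in sS nS.
have mb : (m + 2 * k <= `|b|)%N.
  apply: leq_trans ab; rewrite /m.
  have : (2 * k * (k - 2) <= 2 * k * k)%N by rewrite leq_mul2l leq_subr orbT.
  by move: (_ * _)%N (2 * k * k)%N => u v; lia.
have nX : nonface k `|b|%N (b |` S').
  have kE : (1 + (k - 2)).+1 = k by lia.
  have [SV _ _] := sS; have := nonface_add (x := b) SV _ nS.
  by rewrite kE; apply.
exists (b |` S'); split.
- rewrite sub2E fset1U1 andbT; apply/fset1Ur/(fsubsetP SS); exact: fset21.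
- apply: signed_setW bn _; rewrite (_ : k.+1 = (2 + (k - 2)).+1); last by lia.
  by apply: signed_setU1 sS; lia.
- by have [h _ _] := nX; apply: h; lia.
Qed.

(** With no room above, the other vertices come from [nonface_spread] far below |a|: k - 1 of them,
    or k - 2 if [a] is b - 2 and -(b - 1) takes one place. *)
Lemma witness_high k n (a b : int) : (1 < k)%N -> `|a|%:Z < b ->
  (2 * k * k + 4 * k + 5 <= `|a|)%N -> (`|b| <= n)%N ->
  ~ (a = n%:Z - 1 /\ b = n%:Z) -> witness k n [fset a; b].
Proof.
move=> k1 ab ka bn ne; have od : odd (2 * k - 1) by lia.
have [q bq] : exists q, b = q.+3%:Z by exists (`|b| - 3)%N; lia.
have kq : (2 * k * k + 4 * k + 2 <= q)%N by lia.
have dq : (2 * k - 1 < q.+3)%N by lia.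
rewrite bq in ab bn ne *; move=> {b bq}.
have anti S : S `<=` V q.+3 -> S \notin generated (sphereF (2 * k - 1) q.+3) ->
    S \notin generated (sphereF (2 * k - 1) n).
  by move=> SV; apply: contraNN; apply: sphereF_anti => //.
have [G [sG nG]] := @nonface_spread k (k - 2) (leq_subr _ _).
set m := (2 + _)%N in sG nG.
have mk : (m <= 2 * k * k + 2)%N by rewrite /m [leqRHS]addnC leq_add2l leq_mul2l leq_subr orbT.
have le : (2 + 2 * k * (k - 3) <= m)%N by rewrite leq_add2l leq_mul2l leq_sub2l ?orbT.
clearbody m; move: (2 * k * k)%N kq mk ka => P kq mk ka.
have [GV Gf Gc] := sG.
have kE : ((k - 2).+3 = k.+1)%N by lia.
have [aq2|aN2] := eqVneq a q.+2%:Z.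
  have qn : (q.+3 < n)%N by rewrite ltn_neqAle bn andbT; apply/eqP => e; case: ne; lia.
  have s2 := @signed_setU1 m _ G q.+2%:Z _ sG.
  have s3 := @signed_setU1 q.+2 _ _ q.+3%:Z (ltnSn _) (s2 _).
  exists (q.+3%:Z |` (q.+2%:Z |` G)); split.
  - by rewrite sub2E aq2 !inE !eqxx !orbT.
  - by rewrite -kE; apply: signed_setW bn _; apply: s3; lia.
  apply/negP => /sphereF_consecutive => h.
  have : G \in generated (ballF (2 * k - 1).-2 (uphalf (2 * k - 1)).-1 q.+1).
    apply: h => //; try lia.
    by apply: subV GV; lia.
  rewrite uphalf_odd; last by lia.
  apply/negP/(nonface_ball (m := m)) => //; rewrite /top_idx; try lia.
  by rewrite (_ : k.-1.-1 = k - 2)%N //; lia.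
have [aq1|aN1] := eqVneq a q.+1%:Z.
  have [G' [sG' nG']] : exists G', signed_set m (k - 2) G' /\
      ((2 < k)%N -> nonface (k - 3) m G').
    have [k2|k3] := leqP k 2.
      exists fset0; split; last by lia.
      by rewrite (_ : k - 2 = 0)%N; [apply: signed_set0 | lia].
    have [G' [sG' nG']] := @nonface_spread k (k - 3) (leq_subr _ _).
    exists G'; split; last by move=> _; apply: nonfaceW nG'.
    by rewrite (_ : k - 2 = (k - 3).+1)%N; [apply: signed_setW sG' | lia].
  have [GV' _ _] := sG'.
  have s1 := @signed_setU1 m _ G' q.+1%:Z _ sG'.
  have s2 := @signed_setU1 q.+1 _ _ (- q.+2%:Z) _ (s1 _).
  have s3 := @signed_setU1 q.+2 _ _ q.+3%:Z (ltnSn _) (s2 _ _).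
  have sS : signed_set q.+3 k.+1 (q.+3%:Z |` (- q.+2%:Z |` (q.+1%:Z |` G'))).
    by rewrite -kE; apply: s3; lia.
  exists (q.+3%:Z |` (- q.+2%:Z |` (q.+1%:Z |` G'))); split.
  - by rewrite sub2E aq1 !inE !eqxx !orbT.
  - exact: signed_setW bn sS.
  - apply: anti; first by case: sS.
    by apply: (nonface_top2 (m := m)) => //; lia.
have s1 := @signed_setU1 m _ G a _ sG.
have s2 := @signed_setU1 `|a| _ _ q.+3%:Z _ (s1 _).
have sS : signed_set q.+3 k.+1 (q.+3%:Z |` (a |` G)).
  by rewrite -kE; apply: s2; lia.
exists (q.+3%:Z |` (a |` G)); split.
- by rewrite sub2E !inE !eqxx !orbT.
- exact: signed_setW bn sS.
- apply: anti; first by case: sS.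
  apply: (nonface_top (m := m)) => //; try lia.
  by rewrite (_ : k.-2 = k - 2)%N //; lia.
Qed.

Lemma witness_edge k n (a b : int) : (1 < k)%N ->
  (4 * (2 * k * k + 4 * k + 5) <= n)%N -> (0 < `|a|)%N -> `|a|%:Z < b ->
  (`|b| <= n)%N -> ~ (a = 1 /\ b = 2) -> ~ (a = n%:Z - 1 /\ b = n%:Z) ->
  witness k n [fset a; b].
Proof.
move=> k1; move E : (2 * k * k)%N => P nP a0 ab bn ne1 ne2.
(* If [b] is near [n] and |a| is near [b], the factor 4 in the bound on [n] leaves |a| large enough
   for [witness_high]. *)
have [bP|bP] := leqP (`|b| + P + 5)%N n; first by apply: witness_low; rewrite ?E //; lia.
have [aP|aP] := leqP (`|a| + P + 2 * k + 3)%N `|b|%N.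
  by apply: witness_gap; rewrite ?E //; lia.
by apply: witness_high; rewrite ?E //; lia.
Qed.

(** * The four edges *)

Lemma in_link (t s : face) (D : complex) :
  (s \in link t D) = [&& s \in D, [disjoint s & t]%fset & s `|` t \in D].
Proof. by rewrite /link !inE. Qed.

Lemma centrally_symmetric_link (D : complex) (e : face) :
  centrally_symmetric D -> (forall s, s \in D -> antipode_free s) ->
  (forall s, [disjoint s & e]%fset -> s `|` e \in D ->
     opp_face s `|` e \in D) ->
  centrally_symmetric (link e D).
Proof.
move=> cD fD h s; rewrite !in_link => /and3P[sD ds sD'].
apply/and3P; split; [exact: cD| |exact: h].
apply/fdisjointP => x; rewrite in_opp_face => xs; apply/negP => xe.
have /antipode_freeP/(_ x) := fD _ sD'.
by rewrite !in_fsetU xe xs orbT => /(_ isT).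
Qed.

Lemma in_link_opp (D : complex) (e s : face) : centrally_symmetric D ->
  (opp_face s \in link (opp_face e) D) = (s \in link e D).
Proof.
move=> cD; have cE X : (opp_face X \in D) = (X \in D).
  by apply/idP/idP => /cD; rewrite ?opp_faceK.
rewrite !in_link -opp_faceU !cE; congr [&& _, _ & _].
apply/fdisjointP/fdisjointP => h x.
  by have := h (- x); rewrite !in_opp_face opprK.
by rewrite !in_opp_face => /h.
Qed.

Lemma centrally_symmetric_link_opp (D : complex) (e : face) :
  centrally_symmetric D -> centrally_symmetric (link e D) ->
  centrally_symmetric (link (opp_face e) D).
Proof.
move=> cD ce s sl; rewrite in_link_opp // -[s]opp_faceK; apply: ce.
by rewrite -in_link_opp // opp_faceK.
Qed.

Definition neighborly_edge (k n : nat) (D : complex) (e : face) : Prop :=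
  [/\ e `<=` V n, e \in D, #|` e| = 2%N
    & cs_neighborly (k - 1) (V n `\` (e `|` opp_face e)) (link e D)].

Lemma neighborly_edge_opp k n D e : centrally_symmetric D ->
  neighborly_edge k n D e -> neighborly_edge k n D (opp_face e).
Proof.
move=> cD [eV eD ec en]; split.
- by rewrite -opp_V opp_faceS.
- exact: cD.
- by rewrite card_opp_face.
move=> s sV sc sf; rewrite -(opp_faceK s) in_link_opp //; apply: en.
- rewrite -opp_faceS opp_faceK opp_faceD opp_faceU opp_V opp_faceK.
  by move: sV; rewrite opp_faceK.
- by rewrite card_opp_face.
- by rewrite antipode_free_opp.
Qed.

Lemma neighborly_edgeP k n (e : face) : (0 < k)%N -> (2 * k <= n)%N ->
  e `<=` V n -> #|` e| = 2%N -> antipode_free e ->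
  (forall s : face, s `<=` V n -> [disjoint s & e]%fset -> antipode_free (s `|` e) ->
     (#|` s| < k)%N -> s `|` e \in generated (sphereF (2 * k - 1) n)) ->
  neighborly_edge k n (generated (sphereF (2 * k - 1) n)) e.
Proof.
move=> k0 kn eV ec ef h; have d0 : [disjoint fset0 & e]%fset by apply: fdisjoint0X.
split=> //.
  by have := h fset0 (fsub0set _) d0; rewrite fset0U cardfs0; apply.
move=> s /fsubsetP sV sc sf.
have se x : x \in s -> [&& x \notin e, x \notin opp_face e & x \in V n].
  by move=> /sV; rewrite in_fsetD in_fsetU negb_or -andbA.
have ds : [disjoint s & e]%fset by apply/fdisjointP => x /se/and3P[].
have sVn : s `<=` V n by apply/fsubsetP => x /se/and3P[].
have Xf : antipode_free (s `|` e).
  apply/antipode_freeP => x; rewrite !in_fsetU negb_or => /orP[xs|xe].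
    rewrite (antipode_freeP _ sf _ xs) -in_opp_face.
    by have /and3P[] := se _ xs.
  rewrite (antipode_freeP _ ef _ xe) andbT; apply/negP => /se/and3P[_].
  by rewrite in_opp_face opprK xe.
have XD := h s sVn ds Xf _; rewrite in_link ds XD ?andbT; try lia.
by apply: generated_sub (XD _); [apply: fsubsetUl | lia].
Qed.

(** Removing the edge from a witness leaves k - 1 vertices. They avoid the antipode of the edge
    because the witness is antipode free, so neighborliness would put them in the link and make the
    witness a face. *)
Lemma neighborly_edge_only k n (a b : int) : (1 < k)%N ->
  (4 * (2 * k * k + 4 * k + 5) <= n)%N -> (`|a| < `|b|)%N -> 0 < b ->
  neighborly_edge k n (generated (sphereF (2 * k - 1) n)) [fset a; b] ->
  (a = 1 /\ b = 2) \/ (a = n%:Z - 1 /\ b = n%:Z).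
Proof.
move=> k1 nk ab b0 [eV eD ec en].
move: eV; rewrite sub2E !inV => /andP[aV bV].
case: (boolP ((a == 1) && (b == 2))) => [/andP[/eqP-> /eqP->]|ne1]; first by left.
case: (boolP ((a == n%:Z - 1) && (b == n%:Z))) => [/andP[/eqP-> /eqP->]|ne2]; first by right.
have [] : witness k n [fset a; b].
  by apply: witness_edge => //; lia.
move=> S [eS [SV Sf Sc]].
case/negP; set e := [fset a; b] in eS en ec eD *.
have SE : S = (S `\` e) `|` e by rewrite fsetUDr fsetDv fsetD0; apply/esym/fsetUidPl.
have : S `\` e \in link e (generated (sphereF (2 * k - 1) n)).
  apply: en.
  - apply/fsubsetP => x; rewrite !in_fsetD in_fsetU negb_or in_opp_face.
    move=> /andP[-> xS] /=; rewrite (fsubsetP SV _ xS) andbT.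
    by apply: contra (antipode_freeP _ Sf _ xS); apply: (fsubsetP eS).
  - by rewrite cardfsDS // Sc ec; lia.
  - exact: antipode_freeS (fsubsetDl _ _) Sf.
by rewrite in_link -SE => /and3P[].
Qed.

Theorem theorem5p5 (k : nat) (hk : (2 <= k)%N) :
  exists N : nat, forall n : nat, (N <= n)%N ->
    let D := Delta (2 * k - 1) n in
    let e1 : {fset int} := [fset 1; 2] in
    let e2 : {fset int} := [fset n%:Z - 1; n%:Z] in
    let four : {fset {fset int}} := [fset e1; opp_face e1; e2; opp_face e2] in
    (forall e : {fset int},
       [/\ e `<=` V n, e \in D, #|` e| = 2%N
         & cs_neighborly (k - 1) (V n `\` (e `|` opp_face e)) (link e D)]
       <-> e \in four)
    /\ (forall e : {fset int}, e \in four -> centrally_symmetric (link e D)).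
Proof.
exists (4 * (2 * k * k + 4 * k + 5))%N => n nk D e1 e2 four.
have od : odd (2 * k - 1) by lia.
have dn : (2 * k - 1 < n)%N by lia.
have kn : (2 * k <= n)%N by lia.
have uk : uphalf (2 * k - 1) = k by lia.
have DE : D = generated (sphereF (2 * k - 1) n) by apply: Delta_generated.
have [_ _ /(_ od) si] := all_inv (2 * k - 1).
have cD : centrally_symmetric D.
  by move=> s; rewrite DE -in_generated_opp si_opp.
have fD s : s \in D -> antipode_free s.
  by rewrite DE => /(generated_wf (si_wf si dn))[].
have ltn12 : n%:Z - 1 != n%:Z by lia.
have e1f : signed_set 2 2 e1 by apply: (@signed_set_pair 1 2).
have e2f : signed_set n 2 e2.
  by have := @signed_set_pair (n%:Z - 1) n%:Z; apply; lia.
have [q nq] : exists q, n = q.+2 by exists (n - 2)%N; lia.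
have e2E s : [disjoint s & e2]%fset ->
    (s `|` e2 \in D) = (s \in generated (sphereF (2 * k - 1).-2 q)).
  move=> ds; have q2 : q.+2%:Z \in e2 by rewrite /e2 nq fset22.
  have q1 : q.+1%:Z \in e2 by rewrite /e2 nq !inE; lia.
  have mem x : x \in e2 -> x \in s `|` e2 by move=> xe; rewrite in_fsetU xe orbT.
  have sE : (s `|` e2) `\ q.+2%:Z `\ q.+1%:Z = s.
    apply/fsetP => x; rewrite !in_fsetD1 in_fsetU /e2 in_fset2.
    have -> : n%:Z - 1 = q.+1%:Z by lia.
    have -> : n%:Z = q.+2%:Z by lia.
    case: (eqVneq x q.+1%:Z) => [->|x1] /=.
      by apply/esym/negP => /(fdisjointP ds); rewrite q1.
    case: (eqVneq x q.+2%:Z) => [->|x2] /=; last by rewrite orbF.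
    by apply/esym/negP => /(fdisjointP ds); rewrite q2.
  have d2 : (2 < 2 * k - 1)%N by lia.
  have dq : (2 * k - 1 < q.+1)%N by lia.
  by have := sphereF_top2 od d2 dq (mem _ q1) (mem _ q2); rewrite sE -nq -DE.
have ne1 : neighborly_edge k n D e1.
  have [e1V e1a e1c] := e1f; rewrite DE; apply: neighborly_edgeP => //; first lia.
    by apply: subV e1V; lia.
  move=> s sV ds Xf sc; apply: all_sphNb => //; rewrite ?uk.
    by rewrite fsubUset sV (subV _ e1V) //; lia.
  (* The discount of [weight] is what brings the size |s| + 2 down to at most k. *)
  rewrite /weight /pair12 fsubsetUr /= subn1.
  rewrite cardfsU (disjoint_fsetI0 ds) cardfs0 e1c; lia.
have ne2 : neighborly_edge k n D e2.
  have [e2V e2a e2c] := e2f; rewrite DE; apply: neighborly_edgeP => //; first lia.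
  move=> s sV ds Xf sc; rewrite -DE e2E //; apply: all_sphNb; try lia.
  - apply/fsubsetP => x xs; have := fsubsetP sV _ xs; rewrite !inV.
    have := fdisjointP ds _ xs; rewrite !inE negb_or => /andP[x1 x2].
    have /antipode_freeP/(_ x) := Xf; rewrite !inE xs => /(_ isT).
    rewrite !negb_or => /andP[_ /andP[ox1 ox2]]; lia.
  - exact: antipode_freeS (fsubsetUl _ _) Xf.
  - by rewrite /weight; lia.
have fourE e : e \in four ->
    [\/ e = e1, e = opp_face e1, e = e2 | e = opp_face e2].
  by rewrite !inE -!orbA => /or4P[]/eqP ->;
    [apply: Or41|apply: Or42|apply: Or43|apply: Or44].
have cl1 : centrally_symmetric (link e1 D).
  apply: centrally_symmetric_link => // s ds.
  by rewrite DE; apply: link12_opp.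
have cl2 : centrally_symmetric (link e2 D).
  apply: centrally_symmetric_link => // s ds sD.
  have od2 : odd (2 * k - 1).-2 by lia.
  have [_ _ /(_ od2) si2] := all_inv (2 * k - 1).-2.
  have dos : [disjoint opp_face s & e2]%fset.
    apply/fdisjointP => x; rewrite in_opp_face => xs; apply/negP => xe.
    have /antipode_freeP/(_ x) := fD _ sD.
    by rewrite in_fsetU xe orbT in_fsetU xs => /(_ isT).
  move: sD; rewrite !e2E // -in_generated_opp si_opp //; lia.
split=> e; last first.
  by move=> /fourE[] -> //; apply: centrally_symmetric_link_opp.
split; last first.
  by move=> /fourE[] ->; [exact: ne1 | exact: neighborly_edge_opp
    | exact: ne2 | exact: neighborly_edge_opp].
rewrite -/(neighborly_edge k n D e) => ne.
(* Faces are antipode free, so the two vertices of an edge differ in absolute value; by symmetry and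
   the antipode, |a| < |b| and b > 0 may be assumed. *)
have pos a b : (`|a| < `|b|)%N -> 0 < b -> neighborly_edge k n D [fset a; b] ->
    [fset a; b] = e1 \/ [fset a; b] = e2.
  rewrite DE => ab b0 /neighborly_edge_only h.
  by case: (h hk nk ab b0) => -[-> ->]; [left|right].
have gen a b : (`|a| < `|b|)%N -> neighborly_edge k n D [fset a; b] ->
    [fset a; b] \in four.
  move=> ab nab; case: (ltrP 0 b) => b0.
    by case: (pos a b ab b0 nab) => ->; rewrite !inE eqxx ?orbT.
  have := neighborly_edge_opp cD nab; rewrite opp_faceU !opp_face1 => noab.
  have := pos (- a) (- b) _ _ noab; rewrite !abszN => /(_ ab) h.
  have {h} : opp_face [fset a; b] = e1 \/ opp_face [fset a; b] = e2.
    by rewrite opp_faceU !opp_face1; apply: h; lia.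
  by case=> h; rewrite -[[fset a; b]]opp_faceK h !inE eqxx ?orbT.
have [_ eD ec _] := ne.
have [a ae] : exists a, a \in e by apply/fset0Pn; rewrite -cardfs_eq0 ec.
have /cardfs1P[b eb] : #|` e `\ a| == 1%N.
  by move: (cardfsD1 a e); rewrite ec ae; clear; lia.
have eE : e = [fset a; b] by rewrite -(fsetD1K ae) eb.
have ba : b != a by have := fset11 b; rewrite -eb in_fsetD1 => /andP[].
have bna : b != - a.
  have be : b \in e by rewrite eE fset22.
  by apply/eqP => bE; have /antipode_freeP/(_ _ ae) := fD _ eD; rewrite -bE be.
rewrite eE in ne *; have [ab|ab] := ltnP `|a|%N `|b|%N; first exact: gen.
rewrite fsetUC; apply: gen; last by rewrite fsetUC.
lia.
Qed.
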